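(* Let $K$ be a field, let $S=K[X_1,\ldots,X_n]$ be the polynomial ring with its natural $\mathbb{Z}^n$-grading, and let $M$ be a bounded below $\mathbb{Z}^n$-graded $S$-module. If $\beta^S_{p,a}(M)\neq 0$ for some $0\le p\le n$ and $a\in\mathbb{Z}^n$, then $$\sum_{b\in\mathbb{Z}^n,\ b\preceq a,\ |b|\le |a|-p+i}\beta^S_{i,b}(M)\ \ge\ \binom{p}{i}\quad\text{for } i=0,\ldots,p.$$ In particular: (i) $\beta^S_i(M)\ge\binom{p}{i}$ for $i=0,\ldots,p$; (ii) $\sum_{i=0}^p\beta^S_i(M)\ge 2^p$.
   Context: The $\mathbb{Z}^n$-grading on $S$ is given by $\deg(X_i)=\varepsilon_i$, the $i$-th canonical basis vector of $\mathbb{Z}^n$. For $a,b\in\mathbb{Z}^n$, $|a|=a_1+\cdots+a_n$, and $b\preceq a$ means $b_i\le a_i$ for all $i=1,\ldots,n$. A $\mathbb{Z}^n$-graded $S$-module $M$ is bounded below if there exists $c\in\mathbb{Z}$ with $M_a=0$ whenever $|a|\le c$; it need not be finitely generated. With $K=S/(X_1,\ldots,X_n)$ in degree $0$, the $\mathbb{Z}^n$-graded Betti numbers of $M$ are $\beta^S_{i,a}(M)=\dim_K\operatorname{Tor}^S_i(M,K)_a$ for $i\in\mathbb{N}$, $a\in\mathbb{Z}^n$, and the total Betti numbers are $\beta^S_i(M)=\sum_{a\in\mathbb{Z}^n}\beta^S_{i,a}(M)$ (these may be infinite). *)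

(* Defs.v *)
From HB Require Import structures.
From mathcomp Require Import all_boot all_order all_algebra.
From mathcomp Require Import generic_quotient ring_quotient.
From mathcomp Require Import freeg mpoly.
From mathcomp Require Import boolp classical_sets reals constructive_ereal esum.

Set Implicit Arguments.
Unset Strict Implicit.
Unset Printing Implicit Defensive.

Import GRing.Theory.
Local Open Scope classical_set_scope.
Local Open Scope ring_scope.
Local Open Scope quotient_scope.

Section QuotientModule.
Variables (R : nzRingType) (V : lmodType R) (A : set V).

Definition lspan : set V := [set x | exists s : seq (R * V),
  (forall p, p \in s -> A p.2) /\ x = \sum_(p <- s) p.1 *: p.2].

Lemma lspanD x y : lspan x -> lspan y -> lspan (x + y).
Proof.
move=> [s [As ->]] [t [At ->]]; exists (s ++ t); split; last by rewrite big_cat.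
by move=> p; rewrite mem_cat => /orP[/As|/At].
Qed.

Lemma lspanZ c x : lspan x -> lspan (c *: x).
Proof.
move=> [s [As ->]]; exists [seq (c * p.1, p.2) | p <- s]; split.
  by move=> p /mapP[q /As Aq ->].
by rewrite big_map scaler_sumr; apply: eq_bigr => p _; rewrite scalerA.
Qed.

Definition lspan_pred : {pred V} := fun x => `[< lspan x >].

Lemma lspan_predP x : reflect (lspan x) (x \in lspan_pred).
Proof. exact: asboolP. Qed.

Lemma lspan_zmod_closed : zmod_closed lspan_pred.
Proof.
split; first by apply/lspan_predP; exists [::]; rewrite big_nil.
move=> x y /lspan_predP Ax /lspan_predP Ay; apply/lspan_predP.
by rewrite -scaleN1r; apply: lspanD => //; apply: lspanZ.
Qed.

HB.instance Definition _ :=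
  GRing.isZmodClosed.Build V lspan_pred lspan_zmod_closed.

Definition quotmod := Quotient.quot lspan_pred.

HB.instance Definition _ := GRing.Zmodule.on quotmod.

Definition qpi (x : V) : quotmod := \pi x.

Lemma qpi_eq x y : (qpi x == qpi y) = (x - y \in lspan_pred).
Proof. by rewrite /qpi Quotient.idealrBE. Qed.

Lemma qpi_repr (q : quotmod) : qpi (repr q) = q.
Proof. exact: reprK. Qed.

Lemma qpiD x y : qpi (x + y) = qpi x + qpi y.
Proof. by rewrite /qpi raddfD. Qed.

Definition qscale (c : R) (q : quotmod) : quotmod := qpi (c *: repr q).

Lemma qscaleE c x : qscale c (qpi x) = qpi (c *: x).
Proof.
apply/eqP; rewrite qpi_eq -scalerBr; apply/lspan_predP/lspanZ/lspan_predP.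
by rewrite -qpi_eq qpi_repr.
Qed.

Lemma qscaleA a b q : qscale a (qscale b q) = qscale (a * b) q.
Proof. by rewrite -(qpi_repr q) !qscaleE scalerA. Qed.

Lemma qscale1 q : qscale 1 q = q.
Proof. by rewrite -(qpi_repr q) qscaleE scale1r. Qed.

Lemma qscaleDr c : {morph qscale c : p q / p + q}.
Proof.
by move=> p q; rewrite -(qpi_repr p) -(qpi_repr q) -qpiD !qscaleE -qpiD scalerDr.
Qed.

Lemma qscaleDl q : {morph qscale^~ q : a b / a + b}.
Proof. by move=> a b; rewrite -(qpi_repr q) !qscaleE -qpiD scalerDl. Qed.

HB.instance Definition _ := GRing.Zmodule_isLmodule.Build R quotmod
  qscaleA qscale1 qscaleDr qscaleDl.

Lemma qpiZ c x : qpi (c *: x) = c *: qpi x.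
Proof. by rewrite -qscaleE. Qed.

End QuotientModule.

Section Tensor.
Variable R : comNzRingType.

Section FreeLift.
Variables (T : choiceType) (V : lmodType R) (g : T -> V).

HB.instance Definition _ := GRing.isZmodMorphism.Build {freeg T / R} V
  (fglift g) (lift_is_additive g).

Lemma fglift_scalable : scalable (fglift g : {freeg T / R} -> V).
Proof.
have scU k z : k *: << z >> = << k *g z >> :> {freeg T / R}.
  by apply/eqP/freeg_eqP => x; rewrite coeffZ !coeffU mul1r.
move=> c t; rewrite -[t]freeg_sumE scaler_sumr !(raddf_sum (fglift g)) scaler_sumr.
apply: eq_bigr => x _ /=.
by rewrite -scU scalerA !scU !liftU scalerA.
Qed.

HB.instance Definition _ := GRing.isScalable.Build R {freeg T / R} V *:%R
  (fglift g) fglift_scalable.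

End FreeLift.

(* M (x) N is the free R-module on M * N modulo the bilinearity relations. *)
Definition bilin_rel (M N : lmodType R) : set {freeg (M * N) / R} :=
  [set t | (exists x x' y, t = << (x + x', y) >> - << (x, y) >> - << (x', y) >>) \/
           (exists x y y', t = << (x, y + y') >> - << (x, y) >> - << (x, y') >>) \/
           (exists c x y, t = << (c *: x, y) >> - c *: << (x, y) >>) \/
           (exists c x y, t = << (x, c *: y) >> - c *: << (x, y) >>)].

Definition tensor (M N : lmodType R) : lmodType R := quotmod (@bilin_rel M N).

Definition ptensor (M N : lmodType R) (x : M) (y : N) : tensor M N :=
  qpi (@bilin_rel M N) << (x, y) >>.

Definition ftensor_id (M M' N : lmodType R) (f : M -> M')
    (t : {freeg (M * N) / R}) : {freeg (M' * N) / R} :=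
  fglift (fun p => << (f p.1, p.2) >>) t.

Definition tensor_id (M M' N : lmodType R) (f : M -> M') (t : tensor M N) :
  tensor M' N := qpi _ (ftensor_id f (repr t)).

Section TensorId.
Variables (M M' N : lmodType R) (f : {linear M -> M'}).

Lemma ftensor_idU x (y : N) : ftensor_id f << (x, y) >> = << (f x, y) >>.
Proof. by rewrite /ftensor_id liftU scale1r. Qed.

Lemma ftensor_idB (t u : {freeg (M * N) / R}) :
  ftensor_id f (t - u) = ftensor_id f t - ftensor_id f u.
Proof. exact: raddfB. Qed.

Lemma ftensor_idZ c (t : {freeg (M * N) / R}) :
  ftensor_id f (c *: t) = c *: ftensor_id f t.
Proof. exact: linearZ_LR. Qed.

Lemma ftensor_id_rel t :
  lspan (@bilin_rel M N) t -> lspan (@bilin_rel M' N) (ftensor_id f t).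
Proof.
move=> [s [As ->]]; exists [seq (p.1, ftensor_id f p.2) | p <- s]; split; last first.
  rewrite big_map /ftensor_id linear_sum; apply: eq_bigr => p _.
  by rewrite linearZ.
move=> _ /mapP[[c u] /As /= Au ->] /=; case: Au => [|[|[]]].
- move=> [x [x' [y ->]]]; left; exists (f x), (f x'), y.
  by rewrite !ftensor_idB !ftensor_idU raddfD.
- move=> [x [y [y' ->]]]; right; left; exists (f x), y, y'.
  by rewrite !ftensor_idB !ftensor_idU.
- move=> [b [x [y ->]]]; right; right; left; exists b, (f x), y.
  by rewrite ftensor_idB ftensor_idZ !ftensor_idU linearZ_LR.
- move=> [b [x [y ->]]]; right; right; right; exists b, (f x), y.
  by rewrite ftensor_idB ftensor_idZ !ftensor_idU.
Qed.

Lemma tensor_id_qpi (t : {freeg (M * N) / R}) :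
  tensor_id f (qpi _ t : tensor M N) = qpi _ (ftensor_id f t).
Proof.
apply/eqP; rewrite qpi_eq /ftensor_id -raddfB; apply/lspan_predP/ftensor_id_rel.
by apply/lspan_predP; rewrite -qpi_eq qpi_repr.
Qed.

Lemma tensor_id_pure x (y : N) : tensor_id f (ptensor x y) = ptensor (f x) y.
Proof. by rewrite /ptensor tensor_id_qpi ftensor_idU. Qed.

Lemma tensor_id_linear : linear (@tensor_id M M' N f).
Proof.
move=> c t u; rewrite -(qpi_repr t) -(qpi_repr u) -qpiZ -qpiD !tensor_id_qpi.
by rewrite /ftensor_id linearP qpiD qpiZ.
Qed.

HB.instance Definition _ := GRing.isLinear.Build R (tensor M N) (tensor M' N)
  *:%R (@tensor_id M M' N f) tensor_id_linear.

End TensorId.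

End Tensor.

Section Graded.
Variables (K : fieldType) (n : nat).
Local Notation S := {mpoly K[n]}.

Definition Zn := {ffun 'I_n -> int}.

Definition absdeg (a : Zn) : int := \sum_(i < n) a i.

Definition Zn_le (b a : Zn) : bool := [forall i, (b i <= a i)%R].

Definition expdeg (m : 'X_{1..n}) : Zn := [ffun i => (m i)%:Z].

Definition Scomp (b : Zn) : set S :=
  [set p | forall m, m \in msupp p -> expdeg m = b].

Record grading (M : lmodType S) := Grading {
  gcomp :> Zn -> set M;
  gcomp0 : forall a, gcomp a 0;
  gcompB : forall a x y, gcomp a x -> gcomp a y -> gcomp a (x - y);
  gcompZ : forall b a p x, Scomp b p -> gcomp a x -> gcomp (b + a) (p *: x);
  gcomp_span : forall x, exists (s : seq Zn) (f : Zn -> M),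
    (forall a, gcomp a (f a)) /\ x = \sum_(a <- s) f a;
  gcomp_indep : forall (s : seq Zn) (f : Zn -> M), uniq s ->
    (forall a, gcomp a (f a)) -> \sum_(a <- s) f a = 0 ->
    forall a, a \in s -> f a = 0 }.

Record gmod := GMod { gmod_sort :> lmodType S; gmod_grading : grading gmod_sort }.

Definition gpart (M : gmod) : Zn -> set M := gmod_grading M.

Definition bounded_below (M : gmod) : Prop :=
  exists c : int, forall a, (absdeg a <= c)%R -> gpart a = [set (0 : M)].

Definition graded_map (M N : gmod) (f : M -> N) : Prop :=
  forall a x, gpart a x -> gpart a (f x).

Definition graded_free (F : gmod) : Prop :=
  exists (I : choiceType) (e : I -> F) (d : I -> Zn),
    (forall i, gpart (d i) (e i)) /\
    bijective (fglift e : {freeg I / S} -> F).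

Record graded_free_resolution (M : gmod) := GradedFreeResolution {
  res :> nat -> gmod;
  res_d : forall i, {linear res i.+1 -> res i};
  res_aug : {linear res 0%N -> M};
  res_free : forall i, graded_free (res i);
  res_d_graded : forall i, graded_map (res_d i);
  res_aug_graded : graded_map res_aug;
  res_aug_surj : range res_aug = setT;
  res_exact0 : range (res_d 0%N) = [set x | res_aug x = 0];
  res_exactS : forall i, range (res_d i.+1) = [set x | res_d i x = 0] }.

Definition gtensor_comp (M N : gmod) (a : Zn) : set (tensor M N) :=
  [set t | exists s : seq (M * N),
    (forall z, z \in s -> exists b c, gpart b z.1 /\ gpart c z.2 /\ b + c = a) /\
    t = \sum_(z <- s) ptensor z.1 z.2].

(* K = S / (X_1, ..., X_n), concentrated in degree 0. *)
Definition resfield : lmodType S := quotmod (range (fun i : 'I_n => 'X_i : S^o)).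

Definition resfield_comp (a : Zn) : set resfield :=
  if a == 0 then setT else [set 0].

Lemma resfield_ann (b : Zn) (p : S) (x : resfield) :
  Scomp b p -> b != 0 -> p *: x = 0.
Proof.
move=> pb b0; rewrite -(qpi_repr x) -qpiZ; set q : S := repr x.
have -> : 0 = qpi _ 0 :> resfield by rewrite -[in RHS](scale0r 0) qpiZ scale0r.
apply/eqP; rewrite qpi_eq subr0 [_ *: _](_ : _ = q * p); last exact: mulrC.
rewrite [in q * p](mpolyE p) mulr_sumr big_seq rpred_sum // => m /pb mb.
have [i mi] : exists i, m i != 0%N.
  apply/existsP; apply: contraNT b0; rewrite negb_exists -mb => /forallP m0.
  by apply/eqP/ffunP => i; rewrite !ffunE; have := m0 i; rewrite negbK => /eqP ->.
have Em : m = (m - U_(i) + U_(i))%MM.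
  rewrite submK //; apply/mnm_lepP => j.
  by rewrite mnm1E; case: eqP => // <-; rewrite lt0n.
apply/lspan_predP; exists [:: (p@_m *: q * 'X_[m - U_(i)], 'X_i : S^o)]; split.
  by move=> _ /[!inE] /eqP -> /=; exists i.
rewrite big_seq1 {2}Em mpolyXD -scalerAr mulrA -[in RHS]scalerAl /=.
exact: (scalerAl p@_m (q * 'X_[m - U_(i)]) 'X_i).
Qed.

Fact resfield_comp0 a : resfield_comp a 0.
Proof. by rewrite /resfield_comp; case: ifP. Qed.

Fact resfield_compB a (x y : resfield) :
  resfield_comp a x -> resfield_comp a y -> resfield_comp a (x - y).
Proof. by rewrite /resfield_comp; case: ifP => //= _ -> ->; rewrite subr0. Qed.

Fact resfield_compZ (b a : Zn) (p : S) (x : resfield) :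
  Scomp b p -> resfield_comp a x -> resfield_comp (b + a) (p *: x).
Proof.
rewrite /resfield_comp => pb; case: (eqVneq a 0) => [->|_ ->]; last first.
  by rewrite scaler0; case: ifP.
by rewrite addr0; case: (eqVneq b 0) => // b0 _; apply: (resfield_ann _ pb).
Qed.

Fact resfield_comp_span (x : resfield) : exists (s : seq Zn) (f : Zn -> resfield),
  (forall a, resfield_comp a (f a)) /\ x = \sum_(a <- s) f a.
Proof.
exists [:: 0], (fun a => if a == 0 then x else 0); split.
  by move=> a; rewrite /resfield_comp; case: ifP.
by rewrite big_seq1 eqxx.
Qed.

Fact resfield_comp_indep (s : seq Zn) (f : Zn -> resfield) : uniq s ->
  (forall a, resfield_comp a (f a)) -> \sum_(a <- s) f a = 0 ->
  forall a, a \in s -> f a = 0.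
Proof.
move=> us cf sf0 a as_.
have f0 b : b != 0 -> f b = 0.
  by move=> /negPf b0; have := cf b; rewrite /resfield_comp b0.
have [a0|/f0 //] := eqVneq a 0.
rewrite -sf0 (bigD1_seq a) //= big1 ?addr0 // => b; rewrite a0; exact: f0.
Qed.

Definition resfield_gmod : gmod := GMod
  (Grading resfield_comp0 resfield_compB resfield_compZ resfield_comp_span
     resfield_comp_indep).

(* Homological degree i of the complex F (x) N; its boundary out of degree 0 is
   the zero map. *)
Definition tor_cycle M (F : graded_free_resolution M) (N : gmod) (i : nat) :
    set (tensor (F i) N) :=
  match i with
  | 0 => setT
  | j.+1 => [set t | tensor_id (res_d F j) t = 0]
  end.

Definition tor_boundary M (F : graded_free_resolution M) (N : gmod) (i : nat) :
    set (tensor (F i) N) :=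
  range (tensor_id (N := N) (res_d F i)).

Arguments tor_cycle {M} F N i _.
Arguments tor_boundary {M} F N i _.

(* v induces a basis of the K-vector space Z / B; K acts on S-modules through
   the constant polynomials. *)
Definition is_quot_basis (V : lmodType S) (Z B : set V) (k : nat)
    (v : 'I_k -> V) : Prop :=
  (forall j, Z (v j)) /\
  forall z, Z z ->
    exists! c : {ffun 'I_k -> K}, B (z - \sum_j (c j)%:MP *: v j).

Section Betti.
Variable R : realType.

Definition quot_dim (V : lmodType S) (Z B : set V) : \bar R :=
  if pselect (exists k (v : 'I_k -> V), is_quot_basis Z B v) is left h
  then (sval (cid h))%:R%:E else +oo%E.

(* dim_K Tor_i(M, K)_a, with Tor_i(M, K) = H_i(F (x) K) computed from any graded
   free resolution F of M. *)
Definition betti M (F : graded_free_resolution M) (i : nat) (a : Zn) : \bar R :=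
  quot_dim (tor_cycle F resfield_gmod i `&` gtensor_comp a)
           (tor_boundary F resfield_gmod i `&` gtensor_comp a).

Definition total_betti M (F : graded_free_resolution M) (i : nat) : \bar R :=
  (\esum_(a in [set: Zn]) betti F i a)%E.

End Betti.

End Graded.

(* Main.v *)
From HB Require Import structures.
Require Import Defs.
From mathcomp Require Import all_boot all_order all_algebra.
From mathcomp Require Import freeg mpoly.
From mathcomp Require Import boolp classical_sets reals constructive_ereal esum.
From mathcomp Require Import cardinality fsbigop.
From mathcomp Require Import zify.

(** Write F for the given graded free resolution, with homogeneous bases. Setting
all variables equal to 1 turns F into a complex W of K-vector spaces whose basis
elements carry degrees in Z^n, and whose differential does not increase degrees.
For a convex set A of degrees, let H_i(A) be the homology of the subquotient of W
spanned by the basis elements with degree in A. Two families of sets matter: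
- for the degrees [<= a], H_i is M_a if i = 0, and 0 if i > 0, because the part
  of F of degree a is recovered from W by homogenizing ([deh_surj], [deh_inj]);
- for the single degree a, H_i is Tor_i(M, K)_a, because the differential of
  F (x) K is the degree-preserving part of the differential of W ([betti_neq0],
  [betti_ge]).
The boxes [box f a] interpolate between the two: coordinates in f are equal to
those of a, the others are at most those of a. Algebraically, H_i(box f a) is the
part of degree a of the Koszul homology of M with respect to the variables in f.

If A is the disjoint union of B and C with B closed under going down in A, there
is a long exact sequence H_i(B) -> H_i(A) -> H_i(C) -> H_{i-1}(B). Only two
consequences are used: dim H_i(A) <= dim H_i(B) + dim H_i(C) ([hdim_split]), and
the vanishing of H_i(C) when H_i(A) and H_{i-1}(B) vanish ([acyclic_quotient]).
They are applied to A = box f a, B = box f (a - e_j), C = box (j |: f) a.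

The binomial bound ([binomial_bound]) is an induction on the set T of coordinates
that remain to be made exact. The statement has to be strengthened from modules to
complexes with homology in degrees at most s: if f is disjoint from T,
H_k(box f b) = 0 for all b and k > s, and H_{q+s}(box (f :|: T) a) <> 0, then the
dimensions of H_{i+s}(box (f :|: T) b), over the b <= a with |b| <= |a| - q + i that
agree with a off T, add up to at least 'C(q, i). Pick j in T and put T' = T minus j.
The long exact sequence gives one of two cases.
- H_{q+s}(box (f :|: T') a) <> 0. The bound holds for T', and subadditivity, along
  the finitely many values of the j-th coordinate that contribute because M is
  bounded below, pushes every class down to some b with b_j <= a_j.
- H_{q-1+s}(box (f :|: T') (a - e_j)) <> 0. The same argument yields 'C(q-1, i)
  in the degrees b with b_j < a_j. The degrees with b_j = a_j contribute
  'C(q-1, i-1), by the induction hypothesis for T', j |: f and s + 1: making one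
  coordinate exact raises the top homological degree by at most one.
Pascal's rule concludes. The theorem is the case f = set0, T = setT, s = 0. *)

Set Implicit Arguments.
Unset Strict Implicit.
Unset Printing Implicit Defensive.

Import Order.TTheory GRing.Theory Num.Theory.
Local Open Scope ring_scope.

(** * Linear algebra *)

Section LinearAlgebra.
Variable K : fieldType.

(** For a subspace X of K^r: the rows of A1 are independent vectors of X, those of A2
    are independent modulo X, and together there are r rows. *)
Lemma subspace_splitting r (X : 'rV[K]_r -> Prop) :
  X 0 -> (forall c u v, X u -> X v -> X (c *: u + v)) ->
  exists (r1 r2 : nat) (A1 : 'M[K]_(r1, r)) (A2 : 'M[K]_(r2, r)),
    [/\ (r1 + r2 = r)%N, forall u : 'rV_r1, X (u *m A1),
        forall u : 'rV_r1, u *m A1 = 0 -> u = 0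
      & forall u : 'rV_r2, X (u *m A2) -> u = 0].
Proof.
move=> X0 XP.
have XM k (A : 'M_(k, r)) : (forall i, X (row i A)) -> forall u, X (u *m A).
  move=> XA u; rewrite mulmx_sum_row; apply: (big_ind X) => // [x y Xx Xy|i _].
    by rewrite -[x]scale1r; apply: XP.
  by rewrite -[_ *: _]addr0; apply: XP.
(* A basis of X is read off a matrix of maximal rank among those with row space
   inside X. *)
pose P k := `[< exists A : 'M[K]_r, (forall u : 'rV_r, X (u *m A)) /\ \rank A = k >].
have exP : exists k, P k.
  exists 0%N; apply/asboolP; exists 0; split; last exact: mxrank0.
  by move=> u; rewrite mulmx0.
have ubP k : P k -> (k <= r)%N.
  by move=> /asboolP[A [_ <-]]; apply: rank_leq_row.
have [k /asboolP[A [XA rA]] maxk] := ex_maxnP exP ubP.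
exists (\rank A), (\rank A^C)%MS, (row_base A), (row_base A^C)%MS; split.
- by rewrite mxrank_compl subnKC // rank_leq_row.
- move=> u; have /submxP[D ->] : (u *m row_base A <= A)%MS.
    by rewrite (submx_trans (submxMl _ _)) // eq_row_base.
  exact: XA.
- move=> u /eqP; rewrite mulmx_free_eq0 ?row_base_free //; first by move/eqP.
move=> u Xu; set v := u *m _ in Xu.
have vA : (v <= A)%MS.
  have XAv (w : 'rV_r) : X (w *m (A + v)%MS).
    have : (w *m (A + v)%MS <= A + v)%MS.
      exact: submxMl.
    move=> /sub_addsmxP[[x y] /= ->]; rewrite addrC [y]mx11_scalar mul_scalar_mx.
    by apply: XP.
  have := maxk _ (introT (asboolP _)
    (ex_intro _ (A + v)%MS (conj XAv (erefl _)))).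
  rewrite -rA => le; have : (A + v <= A)%MS.
    by rewrite -(geq_leqif (mxrank_leqif_sup (addsmxSl A v))).
  exact: submx_trans (addsmxSr _ _).
have vC : (v <= A^C)%MS.
  by rewrite (submx_trans (submxMl _ _)) // eq_row_base.
have : (v <= A :&: A^C)%MS by rewrite sub_capmx vA.
rewrite capmx_compl submx0 => /eqP v0.
by apply/eqP; rewrite -(mulmx_free_eq0 _ (row_base_free _)) -/v v0.
Qed.
End LinearAlgebra.

Lemma freegUZ (R : nzRingType) (T : choiceType) (c : R) (x : T) :
  << c *g x >> = c *: << x >> :> {freeg T / R}.
Proof. by apply/eqP/freeg_eqP => z; rewrite coeffZ !coeffU mul1r. Qed.

Lemma coeff_sum (R : nzRingType) (T : choiceType) (I : Type) (r : seq I)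
    (P : pred I) (F : I -> {freeg T / R}) x :
  coeff x (\sum_(i <- r | P i) F i) = \sum_(i <- r | P i) coeff x (F i).
Proof. exact: (big_morph _ (coeffD x) (coeff0 _ x)). Qed.

(** * Complexes filtered by multidegrees *)

Section FilteredComplex.
Variables (K : fieldType) (n : nat).

Lemma Zn_le_refl (a : Zn n) : Zn_le a a.
Proof. by apply/forallP. Qed.

Lemma Zn_le_trans (b a c : Zn n) : Zn_le a b -> Zn_le b c -> Zn_le a c.
Proof.
by move=> /forallP ab /forallP bc; apply/forallP => i; apply: le_trans (bc i).
Qed.

(** A complex of K-vector spaces with bases whose elements have degrees in Z^n;
    the differential of x only involves basis elements of degree at most that
    of x. *)
Record filtered_complex := FilteredComplex {
  fc_basis : nat -> choiceType;
  fc_deg : forall i, fc_basis i -> Zn n;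
  fc_d : forall i, {linear {freeg (fc_basis i.+1) / K} -> {freeg (fc_basis i) / K}};
  fc_dd : forall i w, fc_d i (fc_d i.+1 w) = 0;
  fc_le : forall i x y, coeff y (fc_d i << x >>) != 0 ->
    Zn_le (fc_deg y) (fc_deg x) }.

(** The dimension of Z / B is at least r: r vectors of Z are independent modulo B. *)
Definition dim_ge (V : lmodType K) (Z B : V -> Prop) (r : nat) : Prop :=
  exists v : 'I_r -> V, (forall j, Z (v j)) /\
    forall c : 'rV[K]_r, B (\sum_j c 0 j *: v j) -> c = 0.

Variable W : filtered_complex.
Local Notation chain i := {freeg (fc_basis W i) / K}.
Local Notation d := (@fc_d W _).
Implicit Types A B C : pred (Zn n).

(** The projection onto the span of the basis elements with degree in A. *)
Definition trunc i A (w : chain i) : chain i :=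
  fglift (fun x => if A (fc_deg x) then << x >> else 0) w.

Lemma trunc_is_linear i A : linear (@trunc i A).
Proof. by move=> c u v; rewrite /trunc linearP. Qed.

HB.instance Definition _ i A := GRing.isLinear.Build K (chain i) (chain i) *:%R
  (@trunc i A) (@trunc_is_linear i A).

Lemma coeff_trunc i A x (w : chain i) :
  coeff x (trunc A w) = if A (fc_deg x) then coeff x w else 0.
Proof.
rewrite -[w]freeg_sumE linear_sum !coeff_sum /=.
rewrite [RHS](_ : _ = \sum_(z <- dom w) if A (fc_deg x) then
  coeff x << coeff z w *g z >> else 0); last first.
  by case: ifP => _; [by [] | rewrite big1].
apply: eq_bigr => z _; rewrite /trunc liftU coeffZ coeffU.
case: (eqVneq z x) => [->|zx].
  by case: ifP => _; rewrite ?coeffU ?eqxx ?mul1r // coeff0 mulr0.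
by rewrite mulr0 if_same; case: ifP => _; rewrite ?coeffU ?(negPf zx) ?coeff0 !mulr0.
Qed.

Lemma trunc_id i A (w : chain i) :
  (trunc A w = w) <-> (forall x, coeff x w != 0 -> A (fc_deg x)).
Proof.
split=> [Aw x|Aw]; first by rewrite -Aw coeff_trunc; case: ifP => //; rewrite eqxx.
apply/eqP/freeg_eqP => x; rewrite coeff_trunc; case: ifPn => // Ax.
by apply/esym/eqP; apply: contraNT Ax => /Aw.
Qed.

Lemma trunc_trunc i A B (w : chain i) :
  trunc A (trunc B w) = trunc (predI A B) w.
Proof.
apply/eqP/freeg_eqP => x; rewrite !coeff_trunc /=.
by case: (A _); case: (B _).
Qed.

Lemma eq_trunc i A B (w : chain i) : A =1 B -> trunc A w = trunc B w.
Proof. by move=> AB; apply/eqP/freeg_eqP => x; rewrite !coeff_trunc AB. Qed.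

Lemma trunc_idem i A (w : chain i) : trunc A (trunc A w) = trunc A w.
Proof. by rewrite trunc_trunc; apply: eq_trunc => x /=; rewrite andbb. Qed.

Lemma coeff_fc_d i (w : chain i.+1) y : coeff y (d w) != 0 ->
  exists2 x, coeff x w != 0 & Zn_le (fc_deg y) (fc_deg x).
Proof.
rewrite -{1}[w]freeg_sumE linear_sum coeff_sum => /eqP ne.
have [x xw] : exists2 x, x \in dom w & coeff y (d << coeff x w *g x >>) != 0.
  apply: contrapT => all0; apply: ne; rewrite big_seq big1 // => x xw.
  by apply/eqP; apply: contrapT => /negP ?; apply: all0; exists x.
rewrite freegUZ linearZ coeffZ mulf_eq0 negb_or => /andP[? /fc_le le].
by exists x => //; rewrite -mem_dom.
Qed.

(** Cycles of the subquotient of W spanned by the degrees in A, whose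
    differential is that of W followed by [trunc A]. *)
Definition is_cycle i A : chain i -> Prop :=
  match i with
  | 0 => fun w => trunc A w = w
  | j.+1 => fun w => trunc A w = w /\ trunc A (d w) = 0
  end.

Definition is_boundary i A (w : chain i) : Prop :=
  exists2 u : chain i.+1, trunc A u = u & w = trunc A (d u).

(** Vanishing of the homology H_i(A) of that subquotient. *)
Definition acyclic i A : Prop := forall w, @is_cycle i A w -> is_boundary A w.

(** dim H_i(A) is at least r. *)
Definition hdim_ge i A r : Prop := dim_ge (@is_cycle i A) (@is_boundary i A) r.

Lemma boundary_linear i A c (u v : chain i) :
  is_boundary A u -> is_boundary A v -> is_boundary A (c *: u + v).
Proof.
move=> [u' Au ->] [v' Av ->]; exists (c *: u' + v'); last by rewrite !linearP.
by rewrite linearP /= Au Av.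
Qed.

Lemma boundary0 i A : @is_boundary i A 0.
Proof. by exists 0; rewrite !raddf0. Qed.

Lemma cycle_trunc i A (w : chain i) : is_cycle A w -> trunc A w = w.
Proof. by case: i w => [|i] w // []. Qed.

Lemma cycle_linear i A c (u v : chain i) :
  is_cycle A u -> is_cycle A v -> is_cycle A (c *: u + v).
Proof.
case: i u v => [|i] u v; first by rewrite /= linearP /= => -> ->.
by move=> [Au du] [Av dv]; split; rewrite !linearP /= ?Au ?Av ?du ?dv ?scaler0 ?addr0.
Qed.

Lemma cycle_sum i A r (c : 'rV[K]_r) (v : 'I_r -> chain i) :
  (forall j, is_cycle A (v j)) -> is_cycle A (\sum_j c 0 j *: v j).
Proof.
move=> Zv; apply: (big_ind (@is_cycle i A)) => [|x y Zx Zy|j _].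
- by case: i {v Zv} => [|i] /=; rewrite !raddf0.
- by rewrite -[x]scale1r; apply: cycle_linear.
rewrite -[_ *: _]addr0; apply: cycle_linear => //.
by case: i {v Zv} => [|i] /=; rewrite !raddf0.
Qed.

(** Convexity for the partial order is what makes the truncated differential square
    to zero. *)
Definition convex A := forall a b c : Zn n,
  A a -> A c -> Zn_le a b -> Zn_le b c -> A b.

Lemma trunc_dd i A (w : chain i.+2) : convex A -> trunc A w = w ->
  trunc A (d (trunc A (d w))) = 0.
Proof.
move=> cA /trunc_id Aw; set y := d w.
have -> : trunc A y = y - (y - trunc A y) by rewrite subKr.
rewrite linearB /= fc_dd sub0r raddfN /=.
suff -> : trunc A (d (y - trunc A y)) = 0 by rewrite oppr0.
apply/eqP/freeg_eqP => z; rewrite coeff_trunc coeff0; case: ifP => // Az.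
apply/eqP; apply: contrapT => /negP /coeff_fc_d [x].
rewrite coeffB coeff_trunc; case: ifPn; first by rewrite subrr eqxx.
move=> nAx; rewrite subr0 => /coeff_fc_d [t /Aw At xt] zx.
by rewrite (cA _ _ _ Az At zx xt) in nAx.
Qed.

Lemma boundary_cycle i A (w : chain i) : convex A -> is_boundary A w -> is_cycle A w.
Proof.
move=> cA [u Au ->]; case: i u Au w => [|i] u Au w /=; first exact: trunc_idem.
by rewrite trunc_idem trunc_dd.
Qed.

(** A convex set A of degrees is the disjoint union of B and C, where B is closed
    under going down in A: B spans a subcomplex of A with quotient C. *)
Section Splitting.
Variables A B C : pred (Zn n).
Hypothesis convA : convex A.
Hypothesis AE : forall x, A x = B x || C x.
Hypothesis BC : forall x, ~~ (B x && C x).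
Hypothesis lowB : forall x y, B x -> A y -> Zn_le y x -> B y.

Lemma trunc_splitE i (w : chain i) : trunc A w = trunc B w + trunc C w.
Proof.
apply/eqP/freeg_eqP => x; rewrite coeffD !coeff_trunc AE.
by move: (BC (fc_deg x)); case: (B _); case: (C _); rewrite ?addr0 ?add0r.
Qed.

Lemma trunc_subB i (w : chain i) : trunc B w = w -> trunc A w = w.
Proof. by move=> /trunc_id Bw; apply/trunc_id => x /Bw Bx; rewrite AE Bx. Qed.

Lemma trunc_subC i (w : chain i) : trunc C w = w -> trunc A w = w.
Proof. by move=> /trunc_id Bw; apply/trunc_id => x /Bw Bx; rewrite AE Bx orbT. Qed.

Lemma trunc_BA i (w : chain i) : trunc B (trunc A w) = trunc B w.
Proof.
rewrite trunc_trunc; apply: eq_trunc => x /=; rewrite AE.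
by case: (B x).
Qed.

Lemma trunc_CA i (w : chain i) : trunc C (trunc A w) = trunc C w.
Proof.
rewrite trunc_trunc; apply: eq_trunc => x /=; rewrite AE.
by case: (C x); rewrite ?orbT.
Qed.

Lemma trunc_dB i (w : chain i.+1) : trunc B w = w -> trunc A (d w) = trunc B (d w).
Proof.
move=> /trunc_id Bw; apply/eqP/freeg_eqP => y; rewrite !coeff_trunc.
case: ifP => [Ay|]; last by rewrite AE; case: (B _).
case: ifPn => // nBy; apply/eqP; apply: contrapT => /negP /coeff_fc_d [x /Bw Bx xy].
by rewrite (lowB Bx Ay xy) in nBy.
Qed.

Lemma trunc_CB i (w : chain i) : trunc B w = w -> trunc C w = 0.
Proof.
move=> /trunc_id Bw; apply/eqP/freeg_eqP => y; rewrite !coeff_trunc coeff0.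
case: ifPn => // Cy; apply/eqP; apply: contrapT => /negP /Bw By.
by move: (BC (fc_deg y)); rewrite By Cy.
Qed.

Lemma trunc_CdB i (w : chain i.+1) : trunc B w = w -> trunc C (d w) = 0.
Proof.
move=> Bw; rewrite -trunc_CA trunc_dB // trunc_CB //; exact: trunc_idem.
Qed.

Lemma trunc_CdC i (w : chain i.+1) : trunc A w = w ->
  trunc C (d (trunc C w)) = trunc C (d w).
Proof.
move=> Aw; rewrite -[w in RHS]Aw trunc_splitE !raddfD /=.
by rewrite (trunc_CdB (trunc_idem B w)) add0r.
Qed.

Lemma trunc_eqB i (w : chain i) : trunc A w = w -> trunc C w = 0 -> trunc B w = w.
Proof. by move=> Aw Cw; rewrite -[RHS]Aw trunc_splitE Cw addr0. Qed.

Lemma cycle_sub i (w : chain i) : trunc B w = w -> is_cycle A w -> is_cycle B w.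
Proof.
by case: i w => [|i] w Bw // [_ dw]; split=> //; rewrite -trunc_dB.
Qed.

Lemma cycle_quotient i (w : chain i) : is_cycle A w -> is_cycle C (trunc C w).
Proof.
case: i w => [|i] w /=; first by rewrite trunc_idem.
move=> [Aw dw]; split; first exact: trunc_idem.
by rewrite trunc_CdC // -trunc_CA dw raddf0.
Qed.

(** Exactness of H_i(A) -> H_i(C) -> H_{i-1}(B) at H_i(C). *)
Lemma acyclic_quotient i : acyclic i A ->
  (forall j, i = j.+1 -> acyclic j B) -> acyclic i C.
Proof.
move=> acA acB w Zw.
have Cw := cycle_trunc Zw; have Aw := trunc_subC Cw.
(* The image of w under the connecting map bounds in B, which corrects w to a
   cycle of A. *)
have [b Bb Zb] : exists2 b, trunc B b = b & is_cycle A (w - b).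
  case: i w Zw acA acB Cw Aw => [|i] w Zw acA acB Cw Aw.
    by exists 0; [rewrite raddf0 | rewrite subr0].
  have {acB}acB := acB i erefl; case: Zw => _ Cdw.
  have Adw : trunc A (d w) = trunc B (d w) by rewrite trunc_splitE Cdw addr0.
  have [|b Bb bE] := acB (trunc B (d w)).
    case: i w {acA acB} Cw Aw Cdw Adw => [|i] w Cw Aw Cdw Adw /=.
      exact: trunc_idem.
    rewrite trunc_idem -Adw -trunc_BA trunc_dd // raddf0; split=> //.
  exists b => //; split; first by rewrite linearB /= Aw trunc_subB.
  by rewrite !linearB /= Adw bE trunc_dB // subrr.
have [u Au uE] := acA _ Zb.
exists (trunc C u); first exact: trunc_idem.
by rewrite trunc_CdC // -[RHS]trunc_CA -uE raddfB /= Cw (trunc_CB Bb) subr0.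
Qed.

(** Exactness of H_i(B) -> H_i(A) -> H_i(C) at H_i(A), read on dimensions. *)
Lemma hdim_split i r : hdim_ge i A r ->
  exists r1 r2, [/\ (r1 + r2 = r)%N, hdim_ge i B r1 & hdim_ge i C r2].
Proof.
move=> [v [Zv Iv]].
pose s (u : 'rV[K]_r) := \sum_j u 0 j *: v j.
have sP c x y : s (c *: x + y) = c *: s x + s y.
  rewrite /s scaler_sumr -big_split; apply: eq_bigr => j _ /=.
  by rewrite !mxE scalerDl scalerA.
have s0 : s 0 = 0 by rewrite /s big1 // => j _; rewrite mxE scale0r.
have sM k (M : 'M_(k, r)) (c : 'rV_k) :
    s (c *m M) = \sum_j c 0 j *: s (row j M).
  have sD : {morph s : x y / x + y}.
    by move=> x y; rewrite -[x]scale1r sP !scale1r.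
  rewrite mulmx_sum_row (big_morph s sD s0); apply: eq_bigr => j _.
  by rewrite -[_ *: _]addr0 sP s0 addr0.
have Zs u : is_cycle A (s u) by exact: cycle_sum.
have As u : trunc A (s u) = s u := cycle_trunc (Zs u).
(* Split the span of the r classes along the kernel of H_i(A) -> H_i(C). *)
have [||r1 [r2 [A1 [A2 [rE X1 I1 X2]]]]] :=
    @subspace_splitting K r (fun u => is_boundary C (trunc C (s u))).
- by rewrite s0 raddf0; apply: boundary0.
- by move=> c x y Xx Xy; rewrite sP linearP; apply: boundary_linear.
exists r1, r2; split=> //.
  (* Classes in the kernel are represented by cycles of B. *)
  have /boolp.choice[b bP] (j : 'I_r1) : exists b : chain i,
      is_cycle B b /\ is_boundary A (s (row j A1) - b).
    have [y Cy yE] := X1 (delta_mx 0 j); rewrite -rowE in yE.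
    have Ay := trunc_subC Cy.
    set z := s _ in yE *; have Zz : is_cycle A z := Zs _.
    have Zb : is_cycle A (z - trunc A (d y)).
      rewrite addrC -scaleN1r; apply: cycle_linear => //.
      by apply: boundary_cycle => //; exists y.
    exists (z - trunc A (d y)); split; last first.
      by exists y => //; rewrite opprB addrCA subrr addr0.
    have Bb : trunc B (z - trunc A (d y)) = z - trunc A (d y).
      apply: trunc_eqB; first exact: cycle_trunc Zb.
      by rewrite raddfB /= trunc_CA yE subrr.
    exact: cycle_sub Bb Zb.
  exists b; split=> [j|c]; first by have [] := bP j.
  move=> [y By yE]; apply: I1; apply: Iv; rewrite -/(s _) sM.
  have -> : \sum_j c 0 j *: s (row j A1) =
      \sum_j c 0 j *: (s (row j A1) - b j) + \sum_j c 0 j *: b j.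
    by rewrite -big_split; apply: eq_bigr => j _; rewrite /= scalerBr subrK.
  have BD x1 x2 : is_boundary A x1 -> is_boundary A x2 -> @is_boundary i A (x1 + x2).
    by rewrite -{2}[x1]scale1r; apply: boundary_linear.
  apply: (BD); last by exists y; [apply: trunc_subB | rewrite trunc_dB].
  apply: (big_ind (@is_boundary i A)) => [||j _]; [exact: boundary0 | exact: BD | ].
  rewrite -[_ *: _]addr0; apply: boundary_linear; last exact: boundary0.
  by have [] := bP j.
exists (fun j => trunc C (s (row j A2))); split=> [j|c].
  exact: cycle_quotient.
move=> Bc; apply: X2; rewrite sM linear_sum.
rewrite (eq_bigr (fun j => c 0 j *: trunc C (s (row j A2)))) // => j _.
by rewrite linearZ.
Qed.

End Splitting.
End FilteredComplex.

(** * Lower bounds for sums of dimensions *)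

Section TotalDimension.
Variable n : nat.
Implicit Types (h : Zn n -> nat -> Prop) (D E : Zn n -> Prop).

(** With h b r meaning that some dimension at b is at least r: the sum of these
    dimensions over D, possibly infinite, is at least N. *)
Definition total_ge h D (N : nat) : Prop :=
  exists (s : seq (Zn n)) (r : Zn n -> nat),
    [/\ uniq s, forall b, b \in s -> D b /\ h b (r b) & (N <= \sum_(b <- s) r b)%N].

Lemma total_ge0 h D : total_ge h D 0.
Proof. by exists [::], (fun=> 0%N). Qed.

Lemma total_ge1 h D b N : D b -> h b N -> total_ge h D N.
Proof.
move=> Db hb; exists [:: b], (fun=> N); split=> // [b'|]; last by rewrite big_seq1.
by rewrite inE => /eqP ->.
Qed.

Lemma total_ge_sub h D E N : (forall b, D b -> E b) -> total_ge h D N -> total_ge h E N.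
Proof.
by move=> DE [s [r [us sP Nle]]]; exists s, r; split=> // b /sP[/DE].
Qed.

Lemma total_geU h D1 D2 D N1 N2 :
  (forall b, D1 b -> ~ D2 b) -> (forall b, D1 b \/ D2 b -> D b) ->
  total_ge h D1 N1 -> total_ge h D2 N2 -> total_ge h D (N1 + N2).
Proof.
move=> D12 DD [s1 [r1 [us1 s1P N1le]]] [s2 [r2 [us2 s2P N2le]]].
have s12 b : b \in s2 -> b \notin s1.
  by move=> /s2P[D2b _]; apply/negP => /s1P[/D12].
exists (s1 ++ s2), (fun b => if b \in s1 then r1 b else r2 b); split.
- rewrite cat_uniq us1 us2 andbT; apply/hasPn => b; exact: s12.
- move=> b; rewrite mem_cat; case: ifP => [/s1P[]|_ /s2P[]] *; split=> //; apply: DD; tauto.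
rewrite big_cat leq_add //=.
  by rewrite (leq_trans N1le) // !big_seq leq_sum // => b ->.
by rewrite (leq_trans N2le) // !big_seq leq_sum // => b /s12 /negPf ->.
Qed.

(** If every bound at a point b of D spreads over a set Phi b, and these sets are
    pairwise disjoint, the total bound is preserved. *)
Lemma total_ge_fibres h h' D E (Phi : Zn n -> Zn n -> Prop) N :
  (forall b r, D b -> h b r -> total_ge h' (Phi b) r) ->
  (forall b1 b2 x, D b1 -> D b2 -> Phi b1 x -> Phi b2 x -> b1 = b2) ->
  (forall b x, D b -> Phi b x -> E x) ->
  total_ge h D N -> total_ge h' E N.
Proof.
move=> hh' inj sub [s [r [us sP Nle]]].
suff: total_ge h' (fun x => exists2 b, b \in s & Phi b x) (\sum_(b <- s) r b).
  move=> [s' [r' [us' s'P N'le]]]; exists s', r'; split=> // [x|].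
    by move=> /s'P[[b /sP[Db _] Pbx] hx]; split=> //; apply: sub Pbx.
  exact: leq_trans N'le.
elim: s us sP {Nle} => [|b s IHs] /=; first by rewrite big_nil => *; apply: total_ge0.
move=> /andP[bs us] sP; rewrite big_cons.
have [|Db hb] := sP b; first by rewrite mem_head.
apply: total_geU (hh' _ _ Db hb) (IHs us _).
- move=> x Pbx [b' b's Pb'x]; have [|Db' _] := sP b'; first by rewrite inE b's orbT.
  by move: bs; rewrite (inj _ _ _ Db Db' Pbx Pb'x) b's.
- move=> x [Pbx|[b' b's Pb'x]]; first by exists b; rewrite ?mem_head.
  by exists b'; rewrite // inE b's orbT.
by move=> b' b's; apply: sP; rewrite inE b's orbT.
Qed.

End TotalDimension.

(** * Boxes *)

Section Boxes.
Import mathcomp.boot.finset.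
Variable n : nat.
Implicit Types (a b x : Zn n) (f T : {set 'I_n}).

(** Degrees equal to a in the coordinates in f, and at most a in the others. *)
Definition box f a : pred (Zn n) :=
  fun b => [forall l, if l \in f then b l == a l else (b l <= a l)%R].

Lemma boxP f a b :
  reflect (forall l, if l \in f then b l = a l else (b l <= a l)%R) (box f a b).
Proof.
apply: (iffP forallP) => H l; have := H l; case: ifP => // _; first by move/eqP.
by move=> ->.
Qed.

(** a minus the j-th basis vector. *)
Definition decr j a : Zn n := [ffun l => a l - (l == j)%:R].

Lemma decrE j a l : decr j a l = a l - (l == j)%:R.
Proof. by rewrite ffunE. Qed.

Lemma absdeg_decr j a : absdeg (decr j a) = absdeg a - 1.
Proof.
rewrite /absdeg (eq_bigr (fun l => a l - (l == j)%:R)); last by move=> l _; rewrite decrE.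
rewrite sumrB; congr (_ - _); rewrite (bigD1 j) //= eqxx big1 ?addr0 //.
by move=> l /negPf ->.
Qed.

Lemma absdeg_le a b : Zn_le b a -> absdeg b <= absdeg a.
Proof. by move=> /forallP ba; apply: ler_sum. Qed.

Lemma Zn_le_decr j a : Zn_le (decr j a) a.
Proof. by apply/forallP => l; rewrite decrE; case: (l == j) => /=; lia. Qed.

Lemma convex_box f a : convex (box f a).
Proof.
move=> x y z /boxP xa /boxP za /forallP xy /forallP yz; apply/boxP => l.
move: (xa l) (za l) (xy l) (yz l); case: ifP => _; lia.
Qed.

(** Making one more coordinate exact removes the part with smaller j-th coordinate. *)
Section Step.
Variables (f : {set 'I_n}) (j : 'I_n) (a : Zn n).
Hypothesis jf : j \notin f.

Lemma neq_f l : l \in f -> (l == j) = false.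
Proof. by move=> lf; apply: contraNF jf => /eqP <-. Qed.

Lemma box_splitE x : box f a x = box f (decr j a) x || box (j |: f) a x.
Proof.
apply/boxP/orP => [xa|[/boxP xa|/boxP xa] l]; last 2 first.
- move: (xa l); rewrite decrE; case: ifP => [lf|_].
    by rewrite (neq_f lf) subr0.
  by case: (l == j) => /=; lia.
- by move: (xa l); rewrite in_setU1; case: (l == j); case: (l \in f) => //= ->.
have [xj|xj] := eqVneq (x j) (a j); [right|left]; apply/boxP => l; move: (xa l).
  by rewrite in_setU1; case: (eqVneq l j) => [->|//]; rewrite xj.
rewrite decrE; case: (eqVneq l j) => [->|_]; last by rewrite subr0.
by rewrite (negPf jf) /=; move: xj; lia.
Qed.

Lemma box_disjoint x : ~~ (box f (decr j a) x && box (j |: f) a x).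
Proof.
apply/negP => /andP[/boxP/(_ j) + /boxP/(_ j)].
by rewrite decrE eqxx (negPf jf) setU11 /=; lia.
Qed.

Lemma box_lower x y : box f (decr j a) x -> box f a y -> Zn_le y x ->
  box f (decr j a) y.
Proof.
move=> /boxP xa /boxP ya /forallP yx; apply/boxP => l.
move: (xa l) (ya l) (yx l); rewrite decrE; case: ifP => [lf|_].
  by rewrite (neq_f lf) subr0.
lia.
Qed.

End Step.
End Boxes.

(** * The binomial bound for filtered complexes *)

Section LowerBound.
Import mathcomp.boot.finset.
Variables (K : fieldType) (n : nat) (W : filtered_complex K n).
Implicit Types (a b x : Zn n) (f T : {set 'I_n}).
Local Notation acyclic := (@acyclic K n W).
Local Notation hdim_ge := (@hdim_ge K n W).

Lemma hdim_ge_acyclic i A r : acyclic i A -> hdim_ge i A r -> r = 0%N.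
Proof.
case: r => // r ac [v [Zv Iv]].
have /matrixP/(_ 0 ord0)/eqP : delta_mx 0 ord0 = 0 :> 'rV[K]_r.+1.
  apply: Iv; rewrite (bigD1 ord0) //= big1 => [|l /negPf l0]; rewrite !mxE.
    by rewrite !eqxx scale1r addr0; apply: ac.
  by rewrite l0 andbF scale0r.
by rewrite !mxE !eqxx oner_eq0.
Qed.

Lemma not_acyclic i A : ~ acyclic i A -> hdim_ge i A 1.
Proof.
move=> /existsNP[w /not_implyP[Zw nB]]; exists (fun=> w); split=> // c.
rewrite big_ord1 => Bc; apply/matrixP => k l; rewrite !ord1 mxE.
apply: contrapT => /eqP c0; apply: nB.
rewrite -[w](scalerK c0) -[_ *: _]addr0; apply: boundary_linear => //.
exact: boundary0.
Qed.

Lemma acyclic_box f j a i : j \notin f -> acyclic i (box f a) ->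
  (forall k, i = k.+1 -> acyclic k (box f (decr j a))) -> acyclic i (box (j |: f) a).
Proof.
move=> jf; apply: acyclic_quotient; first exact: convex_box.
- exact: box_splitE.
- exact: box_disjoint.
exact: box_lower.
Qed.

Variable c : int.
Hypothesis bounded : forall b i, absdeg b <= c -> acyclic i (box set0 b).

(** Acyclicity in low degrees is inherited by all boxes. *)
Lemma acyclic_box_bounded f b i : absdeg b <= c -> acyclic i (box f b).
Proof.
have [m] := ubnP #|f|; elim: m f b i => // m IHm f b i fm bc.
have [->|[j jf]] := set_0Vmem f; first exact: bounded.
rewrite -(setD1K jf); have fj : (#|f :\ j| < #|f|)%N.
  by rewrite [X in (_ < X)%N](cardsD1 j) jf.
have fjm : (#|f :\ j| < m)%N by rewrite -ltnS; apply: leq_trans fm; rewrite ltnS.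
apply: acyclic_box => [||k _]; rewrite ?setD11 //; apply: IHm => //.
by rewrite absdeg_decr; lia.
Qed.

(** The dimension of the homology of box f b is at most the sum of those of the boxes
    (j |: f) b', where b' runs below b on the line parallel to the j-th axis. The sum
    is finite by boundedness below. *)
Lemma hdim_ge_column f j b i r : j \notin f -> hdim_ge i (box f b) r ->
  total_ge (fun b' => hdim_ge i (box (j |: f) b'))
    (fun b' => (forall l, l != j -> b' l = b l) /\ b' j <= b j) r.
Proof.
move=> jf; have [m] : exists m : nat, absdeg b <= c + m%:Z.
  by exists `|absdeg b - c|%N; lia.
elim: m b r => [|m IHm] b r bc hb.
  have -> : r = 0%N; last exact: total_ge0.
  by apply: hdim_ge_acyclic hb; apply: acyclic_box_bounded; lia.
have [r1 [r2 [<- h1 h2]]] := hdim_split (@convex_box _ _ _) (box_splitE b jf)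
  (box_disjoint b jf) (box_lower jf) hb.
apply: total_geU (IHm _ _ _ h1) (total_ge1 (D := fun b' => b' = b) erefl h2).
- by move=> b' [_ b'j] b'b; move: b'j; rewrite b'b decrE eqxx /=; lia.
- move=> b' [[b'E b'j]|->] //; split=> [l lj|].
    by rewrite b'E // decrE (negPf lj) subr0.
  by move: b'j; rewrite decrE eqxx /=; lia.
by rewrite absdeg_decr; lia.
Qed.

(** Here s bounds the degrees of the homology of the boxes of f, and making the
    coordinates in T exact creates homology q degrees above s. *)
Lemma binomial_bound T f s a q i : [disjoint f & T] ->
  (forall b k, (s < k)%N -> acyclic k (box f b)) ->
  ~ acyclic (q + s) (box (f :|: T) a) ->
  total_ge (fun b => hdim_ge (i + s) (box (f :|: T) b))
    (fun b => [/\ forall l, l \notin T -> b l = a l, Zn_le b a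
       & absdeg b <= absdeg a - q%:Z + i%:Z]) 'C(q, i).
Proof.
have [m] := ubnP #|T|.
elim: m T f s a q i => // m IHT T f s a [|q] i Tm fT ac nac.
  case: i => [|i]; last by rewrite bin0n; apply: total_ge0.
  apply: (total_ge1 (b := a)); last exact: not_acyclic.
  by split=> //; [exact: Zn_le_refl | lia].
have [T0|[j jT]] := set_0Vmem T.
  by case: nac; rewrite T0 setU0; apply: ac; lia.
set T' := T :\ j; have jT' : j \notin T' by rewrite setD11.
have cT' : (#|T'| < m)%N.
  by rewrite -ltnS; apply: leq_trans Tm; rewrite ltnS [leqRHS](cardsD1 j) jT.
have jf : j \notin f by apply/negP => jf; have := disjointFr fT jf; rewrite jT.
have fT' : [disjoint f & T'] by apply: disjointWr fT; apply: subD1set.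
have jfT' : j \notin f :|: T' by rewrite in_setU negb_or jf.
have TE : T = j |: T' by rewrite setD1K.
have UE : f :|: T = j |: (f :|: T') by rewrite TE setUCA.
rewrite UE in nac *.
have lT' l : l \notin T -> l \notin T' /\ l != j.
  by rewrite TE in_setU1 negb_or => /andP[].
(* Bounds at degrees with j-th coordinate a'_j spread to degrees with j-th
   coordinate at most a'_j. *)
have pull (a' : Zn n) (e : int) N : Zn_le a' a ->
    (forall l, l != j -> a' l = a l) ->
    total_ge (fun b => hdim_ge (i + s) (box (f :|: T') b))
      (fun b => [/\ forall l, l \notin T' -> b l = a' l, Zn_le b a' & absdeg b <= e]) N ->
    total_ge (fun b => hdim_ge (i + s) (box (j |: (f :|: T')) b))
      (fun b => [/\ forall l, l \notin T -> b l = a l, Zn_le b a, b j <= a' j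
         & absdeg b <= e]) N.
  move=> a'a a'E; apply: total_ge_fibres => [b r _|b1 b2 x|b x].
  - exact: hdim_ge_column.
  - move=> [E1 _ _] [E2 _ _] [x1 _] [x2 _]; apply/ffunP => l.
    have [->|lj] := eqVneq l j; first by rewrite E1 ?E2.
    by rewrite -x1 // x2.
  move=> [bE ba' be] [xE xj].
  have xb : Zn_le x b.
    by apply/forallP => l; have [->//|lj] := eqVneq l j; rewrite xE.
  split.
  - by move=> l /lT'[lT'' lj]; rewrite xE // bE // a'E.
  - exact: Zn_le_trans xb (Zn_le_trans ba' a'a).
  - by move/forallP/(_ j): ba'; lia.
  - by move/absdeg_le: xb; lia.
(* By the long exact sequence, a neighbour of the nonzero group is nonzero. *)
have [nacA|acA] := pselect (~ acyclic (q.+1 + s) (box (f :|: T') a)).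
  have := pull a _ _ (Zn_le_refl a) (fun _ _ => erefl)
    (IHT T' f s a q.+1 i cT' fT' ac nacA).
  by apply: total_ge_sub => b [].
have nacB : ~ acyclic (q + s) (box (f :|: T') (decr j a)).
  move=> acB; apply: nac; apply: acyclic_box => //; first exact: contrapT.
  by move=> k [<-].
have dE l : l != j -> decr j a l = a l by rewrite decrE => /negPf ->; rewrite subr0.
have B1 := pull _ _ _ (Zn_le_decr j a) dE
  (IHT T' f s (decr j a) q i cT' fT' ac nacB).
case: i {pull} B1 => [|i] B1.
  rewrite bin0 -(bin0 q); apply: total_ge_sub B1 => b [bE ba _].
  by rewrite absdeg_decr => bs; split=> //; lia.
(* The two summands of Pascal's rule live in b_j < a_j and in b_j = a_j. *)
rewrite binS.
have UE' : j |: (f :|: T') = (j |: f) :|: T' by rewrite setUA.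
have ac2 b k : (s.+1 < k)%N -> acyclic k (box (j |: f) b).
  move=> sk; apply: acyclic_box => //; first by apply: ac; lia.
  by move=> k' kE; apply: ac; lia.
have fT2 : [disjoint (j |: f) & T'].
  by rewrite -setI_eq0 setIUl setU_eq0 !setI_eq0 disjoints1 jT'.
have nac2 : ~ acyclic (q + s.+1) (box ((j |: f) :|: T') a) by rewrite -UE' addnS -addSn.
have := IHT T' (j |: f) s.+1 a q i cT' fT2 ac2 nac2.
rewrite -UE' addnS -addSn; apply: total_geU B1 => b.
  by move=> [_ _ + _] [bE _ _]; rewrite bE // decrE eqxx /=; lia.
case=> [[bE ba _]|[bE ba]]; last first.
  by move=> bs; split=> // [l /lT'[lT'' _]|]; [exact: bE | lia].
by rewrite absdeg_decr => bs; split=> //; lia.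
Qed.
End LowerBound.

(** * Graded modules and homogeneous polynomials *)

Section GradedModules.
Variables (K : fieldType) (n : nat).
Local Notation S := {mpoly K[n]}.
Implicit Types (N : gmod K n) (a b : Zn n).

Section Components.
Variable N : gmod K n.

Lemma gpart0 a : gpart (M := N) a 0.
Proof. exact: gcomp0. Qed.

Lemma gpartB a x y : gpart (M := N) a x -> gpart a y -> gpart a (x - y).
Proof. exact: gcompB. Qed.

Lemma gpartD a x y : gpart (M := N) a x -> gpart a y -> gpart a (x + y).
Proof.
move=> ax ay; rewrite -[y]opprK -[- y]sub0r.
by do 2?apply: gpartB => //; apply: gpart0.
Qed.

Lemma gpart_sum a I (r : seq I) (P : pred I) (y : I -> N) :
  (forall t, P t -> gpart a (y t)) -> gpart a (\sum_(t <- r | P t) y t).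
Proof.
by move=> ay; apply: big_ind => //; [exact: gpart0 | exact: gpartD].
Qed.

(** The homogeneous components of a homogeneous element: those of other degrees
    vanish. *)
Lemma gpart_sum_component (I : eqType) (r : seq I) (deg : I -> Zn n) (y : I -> N) a :
  (forall t, gpart (deg t) (y t)) -> gpart a (\sum_(t <- r) y t) ->
  forall b, \sum_(t <- r | deg t == b) y t =
    if b == a then \sum_(t <- r) y t else 0.
Proof.
move=> gy; set x := \sum_(t <- r) y t => gx b.
pose g c := \sum_(t <- r | deg t == c) y t - (if c == a then x else 0).
pose s := undup (a :: b :: map deg r).
have us : uniq s by rewrite undup_uniq.
have g0 : g b = 0.
  apply: (@gcomp_indep _ _ _ (gmod_grading N) s g) => //.
  - move=> c; apply: gpartB; last by case: eqP => [->|_] //; apply: gpart0.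
    by apply: gpart_sum => t /eqP <-.
  - rewrite /g sumrB; apply/eqP; rewrite subr_eq0; apply/eqP.
    have E (F : Zn n -> N) c : c \in s -> \sum_(c' <- s | c == c') F c' = F c.
      move=> cs; rewrite -big_filter (eq_filter (a2 := pred1 c)).
        by rewrite filter_pred1_uniq // big_seq1.
      by move=> c' /=; rewrite eq_sym.
    have -> : \sum_(c <- s) (if c == a then x else 0) = x.
      rewrite -big_mkcond -[RHS](E (fun=> x) a) ?mem_undup ?mem_head //.
      by apply: eq_bigl => c; rewrite eq_sym.
    rewrite (exchange_big_dep xpredT) //= /x.
    rewrite !big_seq; apply: eq_bigr => t tr.
    by rewrite E // mem_undup !inE map_f ?orbT.
  by rewrite mem_undup !inE eqxx orbT.
by apply/eqP; rewrite -subr_eq0; apply/eqP.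
Qed.
End Components.

(** A homogeneous element in the image of a graded map has a homogeneous preimage
    of the same degree. *)
Lemma graded_preimage (N1 N2 : gmod K n) (f : {linear N1 -> N2}) a y :
  graded_map f -> gpart a (f y) -> exists2 y', gpart a y' & f y' = f y.
Proof.
move=> gf; have [s [g [gs ->]]] := gcomp_span (gmod_grading N1) y => gy.
exists (\sum_(c <- s | c == a) g c).
  by apply: gpart_sum => c /eqP <-; apply: gs.
rewrite !linear_sum in gy *.
have := gpart_sum_component (fun c => gf c _ (gs c)) gy a.
by rewrite eqxx.
Qed.

(** Evaluation at (1, ..., 1). *)
Definition ev1 : S -> K := meval (fun=> 1).

HB.instance Definition _ := GRing.RMorphism.on ev1.

(** The exponent of the monomial of degree a; meaningful when all the coordinates of
    a are nonnegative. *)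
Definition mexp a : 'X_{1..n} := [multinom `|a l|%N | l < n].

Lemma expdegK m : mexp (expdeg m) = m.
Proof. by apply/mnmP => l; rewrite mnmE ffunE. Qed.

Lemma mexpK a : Zn_le 0 a -> expdeg (mexp a) = a.
Proof.
by move=> /forallP a0; apply/ffunP => l; have := a0 l; rewrite !ffunE mnmE => /gez0_abs.
Qed.

Lemma expdeg_ge0 m : Zn_le (n := n) 0 (expdeg m).
Proof. by apply/forallP => l; rewrite !ffunE. Qed.

Lemma ev1X m : ev1 'X_[m] = 1.
Proof. by rewrite /ev1 mevalX big1 // => l _; rewrite expr1n. Qed.

Lemma ev1Z c p : ev1 (c *: p) = c * ev1 p.
Proof. exact: mevalZ. Qed.

(** Polynomials of a given degree are scalar multiples of a single monomial. *)
Lemma ScompE a p : Scomp a p -> p = ev1 p *: 'X_[mexp a].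
Proof.
move=> pa; have pE : p = p@_(mexp a) *: 'X_[mexp a].
  apply/mpolyP => m; rewrite mcoeffZ mcoeffX.
  case: (eqVneq (mexp a) m) => [->|am]; first by rewrite mulr1.
  rewrite mulr0; apply/eqP; apply: contraNT am; rewrite -mcoeff_msupp => /pa <-.
  by rewrite expdegK.
by rewrite {2}pE ev1Z ev1X mulr1.
Qed.

Lemma Scomp_ev1_neq0 a p : Scomp a p -> ev1 p != 0 -> Zn_le 0 a.
Proof.
move=> pa p0; case E : (msupp p) => [|m s].
  by move: p0; rewrite (msuppnil0 E) raddf0 eqxx.
by rewrite -(pa m) ?E ?mem_head //; apply: expdeg_ge0.
Qed.

Lemma Scomp_mcoeff0 a p : Scomp a p -> p@_0 = if a == 0 then ev1 p else 0.
Proof.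
move=> pa; rewrite [in LHS](ScompE pa) mcoeffZ mcoeffX.
have e0 : expdeg 0%MM = 0 :> Zn n by apply/ffunP => l; rewrite !ffunE mnm0E.
case: (eqVneq a 0) => [->|a0]; first by rewrite -e0 expdegK eqxx mulr1.
have [m0|] := eqVneq (mexp a) 0%MM; last by rewrite mulr0.
rewrite mulr1; apply/eqP; apply: contraNT a0 => /(Scomp_ev1_neq0 pa)/mexpK <-.
by rewrite m0 e0.
Qed.

Lemma Scomp_monom c m : Scomp (expdeg m) (c *: 'X_[m] : S).
Proof.
move=> m'; rewrite mcoeff_msupp mcoeffZ mcoeffX.
by case: (eqVneq m m') => [->//|_]; rewrite mulr0 eqxx.
Qed.

End GradedModules.

(** * Homogeneous bases and dehomogenization *)

(** A homogeneous basis of a graded free module, with the coordinate map. *)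
Record graded_basis (K : fieldType) (n : nat) (N : gmod K n) := GradedBasis {
  gb_idx : choiceType;
  gb_vec : gb_idx -> N;
  gb_deg : gb_idx -> Zn n;
  gb_coord : N -> {freeg gb_idx / {mpoly K[n]}};
  gb_gpart : forall j, gpart (gb_deg j) (gb_vec j);
  gb_coordK : cancel gb_coord (fglift gb_vec);
  gb_liftK : cancel (fglift gb_vec) gb_coord }.

Arguments gb_vec {K n N} g j.
Arguments gb_deg {K n N} g j.
Arguments gb_coord {K n N} g x.
Arguments gb_gpart {K n N} g j.
Arguments gb_coordK {K n N} g x.
Arguments gb_liftK {K n N} g x.

Lemma graded_free_basis (K : fieldType) (n : nat) (N : gmod K n) :
  graded_free N -> exists b : graded_basis N, True.
Proof.
by move=> [I [e [d [ge [g gK Kg]]]]]; exists (GradedBasis ge Kg gK).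
Qed.

Section Basis.
Variables (K : fieldType) (n : nat) (N : gmod K n) (bas : graded_basis N).
Local Notation S := {mpoly K[n]}.
Local Notation e := (gb_vec bas).
Local Notation deg := (gb_deg bas).
Local Notation T := (gb_idx bas).

(** The j-th coordinate. *)
Definition coef j (x : N) : S := coeff j (gb_coord bas x).

Lemma gb_coord_linear : linear (gb_coord bas).
Proof.
move=> c x y; apply: (can_inj (gb_liftK bas)).
by rewrite gb_coordK linearP /= !gb_coordK.
Qed.

Lemma coef_is_linear j c x y : coef j (c *: x + y) = c * coef j x + coef j y.
Proof. by rewrite /coef gb_coord_linear coeffD coeffZ. Qed.

Lemma coef0 j : coef j 0 = 0.
Proof. by have := coef_is_linear j (-1) 0 0; rewrite scaler0 addr0 mulN1r addNr. Qed.

Lemma coefD j : {morph coef j : x y / x + y}.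
Proof. by move=> x y; have := coef_is_linear j 1 x y; rewrite scale1r mul1r. Qed.

Lemma coefZ j c x : coef j (c *: x) = c * coef j x.
Proof. by have := coef_is_linear j c x 0; rewrite addr0 coef0 addr0. Qed.

Lemma coef_sum j I (r : seq I) (P : pred I) (y : I -> N) :
  coef j (\sum_(t <- r | P t) y t) = \sum_(t <- r | P t) coef j (y t).
Proof. exact: (big_morph _ (coefD j) (coef0 j)). Qed.

Lemma coef_vec j k : coef j (e k) = (k == j)%:R.
Proof.
have -> : e k = fglift e << k >> by rewrite liftU scale1r.
by rewrite /coef gb_liftK coeffU mul1r.
Qed.

Lemma sum_coef x : x = \sum_(j <- dom (gb_coord bas x)) coef j x *: e j.
Proof.
rewrite -[LHS](gb_coordK bas) -[in LHS](freeg_sumE (gb_coord bas x)) linear_sum.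
by apply: eq_bigr => j _; rewrite /= liftU.
Qed.

Lemma coef_inj x y : (forall j, coef j x = coef j y) -> x = y.
Proof.
move=> E; apply: (can_inj (gb_coordK bas)); apply/eqP/freeg_eqP => j; exact: E.
Qed.

(** Coordinates of homogeneous elements are homogeneous. *)
Lemma coef_Scomp a x j : gpart a x -> Scomp (a - deg j) (coef j x).
Proof.
move=> ax m mj; apply/eqP; rewrite -(inj_eq (addIr (deg j))) subrK.
apply/negPn/negP => ne.
(* Decompose x into its terms c * X^m' * e_k and compare components. *)
pose r := [seq (k, m') | k <- dom (gb_coord bas x), m' <- msupp (coef k x)].
pose y (t : T * 'X_{1..n}) : N := ((coef t.1 x)@_t.2 *: 'X_[t.2] : S) *: e t.1.
have gy t : gpart (expdeg t.2 + deg t.1) (y t).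
  by apply: gcompZ; [apply: Scomp_monom | apply: gb_gpart].
have xE : x = \sum_(t <- r) y t.
  rewrite {1}(sum_coef x) big_allpairs_dep; apply: eq_bigr => k _.
  by rewrite {1}(mpolyE (coef k x)) scaler_suml.
have ax' := ax; rewrite xE in ax'.
have := gpart_sum_component gy ax' (expdeg m + deg j); rewrite (negPf ne).
move/(congr1 (fun z => (coef j z)@_m)); rewrite coef_sum coef0 mcoeff0 raddf_sum /=.
rewrite -big_filter (bigD1_seq (j, m)) /=.
- rewrite /y /= coefZ coef_vec eqxx mulr1 mcoeffZ mcoeffX eqxx mulr1 big1.
    by rewrite addr0 => /eqP; rewrite mcoeff_eq0 mj.
  move=> [k m'] /= ne'; rewrite coefZ coef_vec.
  case: (eqVneq k j) ne' => [->|_ _]; last by rewrite mulr0 mcoeff0.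
  rewrite mulr1 mcoeffZ mcoeffX xpair_eqE eqxx /= => /negPf ->.
  by rewrite mulr0.
- rewrite mem_filter /= eqxx /=; apply/allpairsPdep; exists j, m; split=> //.
  by rewrite mem_dom; apply: contraTneq mj => E; rewrite /coef E msupp0.
apply: filter_uniq; apply: allpairs_uniq_dep => [|k _|[k1 m1] [k2 m2] _ _ /= [-> ->]] //.
exact: uniq_dom.
Qed.

(** Dehomogenization: all variables are set to 1 in the coordinates. *)
Definition deh (x : N) : {freeg T / K} :=
  \sum_(j <- dom (gb_coord bas x)) << ev1 (coef j x) *g j >>.

Lemma coeff_deh j x : coeff j (deh x) = ev1 (coef j x).
Proof.
rewrite coeff_sum; have [jx|jx] := boolP (j \in dom (gb_coord bas x)).
  rewrite (bigD1_seq j) ?uniq_dom //= coeffU eqxx mulr1 big1 ?addr0 // => k.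
  by rewrite coeffU => /negPf ->; rewrite mulr0.
rewrite /coef coeff_outdom // raddf0 big1_seq // => k /= kx; rewrite coeffU.
by case: (eqVneq k j) kx jx => [->->//|_]; rewrite mulr0.
Qed.

Lemma dehD : {morph deh : x y / x + y}.
Proof. by move=> x y; apply/eqP/freeg_eqP => j; rewrite coeffD !coeff_deh coefD raddfD. Qed.

Lemma dehZ c x : deh (c *: x) = ev1 c *: deh x.
Proof. by apply/eqP/freeg_eqP => j; rewrite coeffZ !coeff_deh coefZ rmorphM. Qed.

Lemma deh_vec j : deh (e j) = << j >>.
Proof.
by apply/eqP/freeg_eqP => k; rewrite coeff_deh coef_vec coeffU mul1r rmorph_nat.
Qed.

Lemma deh0 : deh 0 = 0.
Proof. by apply/eqP/freeg_eqP => j; rewrite coeff0 coeff_deh coef0 raddf0. Qed.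

Lemma deh_sum I (r : seq I) (P : pred I) (y : I -> N) :
  deh (\sum_(t <- r | P t) y t) = \sum_(t <- r | P t) deh (y t).
Proof. exact: (big_morph _ dehD deh0). Qed.

Lemma deh_le a x j : gpart a x -> coeff j (deh x) != 0 -> Zn_le (deg j) a.
Proof.
rewrite coeff_deh => /coef_Scomp - /(_ j) /Scomp_ev1_neq0 H /H /forallP ja.
by apply/forallP => l; have := ja l; rewrite !ffunE subr_ge0.
Qed.

(** With [deh_le] and [deh_surj]: [deh] maps the part of N of degree a bijectively onto
    the span of the basis elements of degree at most a. *)
Lemma deh_inj a x : gpart a x -> deh x = 0 -> x = 0.
Proof.
move=> ax x0; apply: coef_inj => j.
by rewrite coef0 (ScompE (coef_Scomp (j := j) ax)) -coeff_deh x0 coeff0 scale0r.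
Qed.

Lemma deh_surj a (w : {freeg T / K}) :
  (forall j, coeff j w != 0 -> Zn_le (deg j) a) -> exists2 x, gpart a x & deh x = w.
Proof.
move=> wa; exists (\sum_(j <- dom w) (coeff j w *: 'X_[mexp (a - deg j)] : S) *: e j).
  rewrite big_seq; apply: gpart_sum => j; rewrite mem_dom => /wa ja.
  rewrite -[X in gpart X](subrK (deg j)); apply: gcompZ; last exact: gb_gpart.
  rewrite -[X in Scomp X]mexpK; first exact: Scomp_monom.
  by move/forallP: ja => ja; apply/forallP => l; have := ja l; rewrite !ffunE subr_ge0.
rewrite deh_sum -[RHS]freeg_sumE; apply: eq_bigr => j _.
by rewrite dehZ ev1Z ev1X mulr1 deh_vec freegUZ.
Qed.

End Basis.

Arguments coef {K n N} bas j x.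

(** * The filtered complex of a resolution *)

Section Dehomogenization.
Variables (K : fieldType) (n : nat) (M : gmod K n) (F : graded_free_resolution M).
Variable bas : forall i, graded_basis (F i).
Local Notation S := {mpoly K[n]}.

Lemma res_dd i x : res_d F i (res_d F i.+1 x) = 0.
Proof.
have : range (res_d F i.+1) (res_d F i.+1 x) by exists x.
by rewrite res_exactS.
Qed.

(** The differential of the resolution with all variables set to 1. *)
Definition deh_d i (w : {freeg (gb_idx (bas i.+1)) / K}) : {freeg (gb_idx (bas i)) / K} :=
  fglift (fun j => deh (bas i) (res_d F i (gb_vec (bas i.+1) j))) w.

Lemma deh_d_linear i : linear (@deh_d i).
Proof. by move=> c x y; rewrite /deh_d linearP. Qed.

HB.instance Definition _ i := GRing.isLinear.Build K _ _ *:%R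
  (@deh_d i) (@deh_d_linear i).

Lemma deh_dE i x : deh_d (deh (bas i.+1) x) = deh (bas i) (res_d F i x).
Proof.
rewrite [in RHS](sum_coef (bas i.+1) x) [deh _ x]/deh !linear_sum deh_sum.
by apply: eq_bigr => j _ /=; rewrite /deh_d liftU linearZ_LR dehZ.
Qed.

Lemma deh_dd i w : deh_d (@deh_d i.+1 w) = 0.
Proof.
rewrite -[w]freeg_sumE !linear_sum big1 // => j _.
by rewrite /= [X in deh_d X]/deh_d liftU linearZ_LR /= deh_dE res_dd deh0 scaler0.
Qed.

Lemma deh_d_le i x y : coeff y (@deh_d i << x >>) != 0 ->
  Zn_le (gb_deg (bas i) y) (gb_deg (bas i.+1) x).
Proof.
rewrite /deh_d liftU scale1r; apply: deh_le; apply: res_d_graded.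
exact: gb_gpart.
Qed.

(** The resolution with all variables set to 1. *)
Definition dehomogenization : filtered_complex K n :=
  FilteredComplex (fc_basis := fun i => gb_idx (bas i))
    (fc_deg := fun i => gb_deg (bas i)) (fc_d := fun i => @deh_d i) deh_dd deh_d_le.
Local Notation W := dehomogenization.

Lemma box0 (b x : Zn n) : box finset.set0 b x = Zn_le x b.
Proof. by apply: eq_forallb => l; rewrite finset.in_set0. Qed.

Lemma gpart_trunc i b x : gpart (M := F i) b x ->
  trunc (W := W) (box finset.set0 b) (deh (bas i) x) = deh (bas i) x.
Proof. by move=> bx; apply/trunc_id => j /(deh_le bx); rewrite box0. Qed.

Lemma trunc_gpart i b (w : {freeg (fc_basis W i) / K}) :
  trunc (box finset.set0 b) w = w -> exists2 x, gpart b x & deh (bas i) x = w.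
Proof. by move=> /trunc_id wb; apply: deh_surj => j /wb; rewrite box0. Qed.

Lemma boundary_deh i b y : gpart b (res_d F i y) ->
  is_boundary (W := W) (box finset.set0 b) (deh (bas i) (res_d F i y)).
Proof.
move=> by_; have [y' y'b y'E] := graded_preimage (@res_d_graded _ _ _ F i) by_.
exists (deh (bas i.+1) y'); first exact: gpart_trunc.
by rewrite /= deh_dE y'E gpart_trunc.
Qed.

(** The truncation to degrees at most b is the part of F of degree b, a resolution of
    the part of M of degree b. *)
Lemma dehomogenization_acyclicS i b : acyclic W i.+1 (box finset.set0 b).
Proof.
move=> _ [/trunc_gpart[x xb <-]]; rewrite /= deh_dE gpart_trunc; last exact: res_d_graded.
move=> /deh_inj dx; have {}dx : res_d F i x = 0 by apply: dx; apply: res_d_graded xb.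
have [y _ yE] : range (res_d F i.+1) x by rewrite res_exactS.
by rewrite -yE in xb *; apply: boundary_deh.
Qed.

Lemma dehomogenization_acyclic0 b : gpart (M := M) b = [set 0]%classic ->
  acyclic W 0 (box finset.set0 b).
Proof.
move=> Mb _ /trunc_gpart[x xb <-].
have := res_aug_graded xb; rewrite Mb => /= x0.
have [y _ yE] : range (res_d F 0) x by rewrite res_exact0.
by rewrite -yE in xb *; apply: boundary_deh.
Qed.

End Dehomogenization.

(** * Tensor products with the residue field *)

Section PureTensors.
Variables (R : comNzRingType) (M N : lmodType R).

Lemma tensor_rel (t u : {freeg (M * N) / R}) : bilin_rel (t - u) ->
  qpi (@bilin_rel R M N) t = qpi (@bilin_rel R M N) u.
Proof.
move=> tu; apply/eqP; rewrite qpi_eq; apply/lspan_predP.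
exists [:: (1, t - u)]; split; last by rewrite big_seq1 scale1r.
by move=> p; rewrite inE => /eqP ->.
Qed.

Lemma ptensorDl (x x' : M) (y : N) : ptensor (x + x') y = ptensor x y + ptensor x' y.
Proof.
rewrite /ptensor -qpiD; apply: tensor_rel.
by left; exists x, x', y; rewrite opprD addrA.
Qed.

Lemma ptensorZl c (x : M) (y : N) : ptensor (c *: x) y = c *: ptensor x y.
Proof.
rewrite /ptensor -qpiZ; apply: tensor_rel.
by right; right; left; exists c, x, y.
Qed.

Lemma ptensorZr c (x : M) (y : N) : ptensor x (c *: y) = c *: ptensor x y.
Proof.
rewrite /ptensor -qpiZ; apply: tensor_rel.
by right; right; right; exists c, x, y.
Qed.

Lemma ptensor0l (y : N) : ptensor (0 : M) y = 0.
Proof. by rewrite -[0 in LHS](scale0r 0) ptensorZl scale0r. Qed.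

Lemma ptensor0r (x : M) : ptensor x (0 : N) = 0.
Proof. by rewrite -[0 in LHS](scale0r 0) ptensorZr scale0r. Qed.

Lemma ptensor_suml I (r : seq I) (P : pred I) (x : I -> M) (y : N) :
  ptensor (\sum_(i <- r | P i) x i) y = \sum_(i <- r | P i) ptensor (x i) y.
Proof.
exact: (big_morph (fun x => ptensor x y) (fun x x' => ptensorDl x x' y)
  (ptensor0l y)).
Qed.

Lemma qpi0 (V : lmodType R) (A : V -> Prop) : qpi A 0 = 0.
Proof. by rewrite -[0 in LHS](scale0r 0) qpiZ scale0r. Qed.

Lemma qpi_sum (V : lmodType R) (A : V -> Prop) I (r : seq I) (P : pred I) (x : I -> V) :
  qpi A (\sum_(i <- r | P i) x i) = \sum_(i <- r | P i) qpi A (x i).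
Proof. exact: (big_morph _ (qpiD A) (qpi0 A)). Qed.

Lemma tensor_sum (t : tensor M N) : exists s : seq (R * (M * N)),
  t = \sum_(z <- s) z.1 *: ptensor z.2.1 z.2.2.
Proof.
exists [seq (coeff z (repr t), z) | z <- dom (repr t)].
rewrite big_map -[LHS]qpi_repr -[in LHS](freeg_sumE (repr t)) qpi_sum.
by apply: eq_bigr => -[x y] _ /=; rewrite /ptensor -qpiZ freegUZ.
Qed.

(** The universal property of the tensor product. *)
Lemma bilinear_lift (V : lmodType R) (g : M -> N -> V) :
  (forall y, linear (g^~ y)) -> (forall x, linear (g x)) ->
  exists h : {linear tensor M N -> V}, forall x y, h (ptensor x y) = g x y.
Proof.
move=> gl gr.
pose l : {linear {freeg (M * N) / R} -> V} := fglift (fun z : M * N => g z.1 z.2).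
have lU x y : l << (x, y) >> = g x y by rewrite /l /= liftU scale1r.
have g0l y : g 0 y = 0.
  by have := gl y (-1) 0 0; rewrite scaler0 addr0 scaleN1r addNr.
have g0r x : g x 0 = 0.
  by have := gr x (-1) 0 0; rewrite scaler0 addr0 scaleN1r addNr.
have l0 u : u \in lspan_pred (@bilin_rel R M N) -> l u = 0.
  move=> /lspan_predP[s [sP ->]]; rewrite linear_sum big_seq big1 // => -[c t] /sP /=.
  rewrite linearZ_LR => tP; suff -> : l t = 0 by rewrite scaler0.
  case: tP => [|[|[]]].
  - move=> [x [x' [y ->]]]; rewrite !linearB !lU -[x in g (x + _)]scale1r gl.
    by rewrite scale1r -addrA -opprD subrr.
  - move=> [x [y [y' ->]]]; rewrite !linearB !lU -[y in g _ (y + _)]scale1r gr.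
    by rewrite scale1r -addrA -opprD subrr.
  - move=> [b [x [y ->]]]; rewrite linearB linearZ_LR !lU.
    by rewrite -[b *: x]addr0 gl g0l addr0 subrr.
  - move=> [b [x [y ->]]]; rewrite linearB linearZ_LR !lU.
    by rewrite -[b *: y]addr0 gr g0r addr0 subrr.
pose h (t : tensor M N) : V := l (repr t).
have hpi u : h (qpi _ u) = l u.
  apply/eqP; rewrite -subr_eq0 /h -linearB; apply/eqP/l0.
  by rewrite -qpi_eq qpi_repr.
have hlin : linear h.
  move=> c t u; rewrite -(qpi_repr t) -(qpi_repr u) -qpiZ -qpiD !hpi.
  exact: linearP.
pose hL := GRing.isLinear.Build R (tensor M N) V *:%R h hlin.
pose H : {linear tensor M N -> V} := HB.pack h hL.
by exists H => x y; rewrite /= hpi.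
Qed.

End PureTensors.

Section ScalarRestriction.
Variables (K : fieldType) (n : nat).

(** An S-module seen as a K-vector space, with K acting through constants. *)
Definition restrict_scalars (V : lmodType {mpoly K[n]}) : Type := V.

HB.instance Definition _ V := GRing.Zmodule.on (restrict_scalars V).

Section Instance.
Variable V : lmodType {mpoly K[n]}.
Definition restrict_scale (c : K) (v : restrict_scalars V) : restrict_scalars V :=
  c%:MP *: (v : V).

Lemma restrict_scaleA a b v :
  restrict_scale a (restrict_scale b v) = restrict_scale (a * b) v.
Proof. by rewrite /restrict_scale scalerA -mpolyCM. Qed.

Lemma restrict_scale1 : left_id 1 restrict_scale.
Proof. by move=> v; rewrite /restrict_scale scale1r. Qed.

Lemma restrict_scaleDr : right_distributive restrict_scale +%R.
Proof. by move=> c u v; rewrite /restrict_scale scalerDr. Qed.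

Lemma restrict_scaleDl v : {morph restrict_scale^~ v : a b / a + b}.
Proof. by move=> a b; rewrite /restrict_scale mpolyCD scalerDl. Qed.

HB.instance Definition _ := GRing.Zmodule_isLmodule.Build K (restrict_scalars V)
  restrict_scaleA restrict_scale1 restrict_scaleDr restrict_scaleDl.
End Instance.
End ScalarRestriction.

Section ResidueField.
Variables (K : fieldType) (n : nat).
Local Notation S := {mpoly K[n]}.
Local Notation k := (resfield K n).

(** The class of 1, a K-basis of the residue field. *)
Definition res_one : k := qpi _ (1 : S^o).

(** S acts on the residue field through constant terms. *)
Lemma resfield_scale (p : S) (y : k) : p *: y = (p@_0)%:MP *: y.
Proof.
rewrite {1}(mpolyE p) scaler_suml.
have X0 m : m != 0%MM -> (p@_m *: 'X_[m] : S) *: y = 0.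
  move=> m0; apply: (resfield_ann (b := expdeg m)); first exact: Scomp_monom.
  apply: contraNneq m0 => e0; rewrite -(expdegK m) e0.
  by apply/eqP/mnmP => l; rewrite mnmE ffunE mnm0E.
have [m0|m0] := boolP (0%MM \in msupp p).
  rewrite (bigD1_seq 0%MM) ?msupp_uniq // big1; last by move=> m; apply: X0.
  by rewrite Monoid.mulm1 mpolyX0 alg_mpolyC.
rewrite (memN_msupp_eq0 m0) scale0r big1_seq // => m /andP[_ mp]; apply: X0.
by apply: contraNneq m0 => <-.
Qed.

Lemma resfield_gen (y : k) : exists c : K, y = c%:MP *: res_one.
Proof.
exists (repr y : S)@_0; rewrite -resfield_scale /res_one -qpiZ -[LHS]qpi_repr.
by congr (qpi _ _); rewrite /GRing.scale /= mulr1.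
Qed.

Lemma res_one_free (c : K) : c%:MP *: res_one = 0 -> c = 0.
Proof.
rewrite /res_one -qpiZ -(qpi0 _) => /eqP; rewrite qpi_eq subr0.
move=> /lspan_predP[s [sP /(congr1 (mcoeff 0%MM))]].
rewrite [_ *: _](_ : _ = c%:MP :> S); last exact: mulr1.
rewrite mcoeffC eqxx mulr1 raddf_sum big_seq big1 // => -[q x] /sP[i _ /= <-].
rewrite [_ *: _](_ : _ = q * 'X_i :> S) // rmorphM /= mcoeffX.
by case: eqP => [/mnmP/(_ i)|]; rewrite ?mulr0 // mnm1E eqxx mnm0E.
Qed.

End ResidueField.

Section TensorResidue.
Variables (K : fieldType) (n : nat) (N : gmod K n) (bas : graded_basis N).
Local Notation S := {mpoly K[n]}.
Local Notation k := (resfield K n).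
Local Notation T := (gb_idx bas).
Local Notation one := (res_one K n).

(** The constant terms of the coordinates, that is, the class of x modulo the
    variables. *)
Definition const_part (x : N) : {freeg T / K} :=
  \sum_(j <- dom (gb_coord bas x)) << (coef bas j x)@_0 *g j >>.

Lemma const_part_gpart a x : gpart a x ->
  forall j, coeff j (const_part x) = if gb_deg bas j == a then coeff j (deh bas x) else 0.
Proof.
move=> ax j; have E : coeff j (const_part x) = (coef bas j x)@_0.
  rewrite coeff_sum; have [jx|jx] := boolP (j \in dom (gb_coord bas x)).
    rewrite (bigD1_seq j) ?uniq_dom //= coeffU eqxx mulr1 big1 ?addr0 // => i.
    by rewrite coeffU => /negPf ->; rewrite mulr0.
  rewrite /coef coeff_outdom // mcoeff0 big1_seq // => i /= ix; rewrite coeffU.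
  by case: (eqVneq i j) ix jx => [->->//|_]; rewrite mulr0.
rewrite E coeff_deh (Scomp_mcoeff0 (coef_Scomp (j := j) ax)).
by rewrite subr_eq0 eq_sym.
Qed.

(** The K-linear isomorphism from the vector space on the basis of N to N (x) K. *)
Definition to_tensor (w : {freeg T / K}) : restrict_scalars (tensor N k) :=
  fglift (fun j => ptensor (gb_vec bas j) one : restrict_scalars (tensor N k)) w.

Lemma to_tensor_linear : linear to_tensor.
Proof. by move=> c u v; rewrite /to_tensor linearP. Qed.

HB.instance Definition _ := GRing.isLinear.Build K _ _ *:%R to_tensor to_tensor_linear.

Lemma to_tensorU c j : to_tensor << c *g j >> = c%:MP *: ptensor (gb_vec bas j) one.
Proof. by rewrite /to_tensor liftU. Qed.

Lemma to_tensorE w : to_tensor w =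
  \sum_(j <- dom w) (coeff j w)%:MP *: ptensor (gb_vec bas j) one.
Proof.
rewrite -{1}(freeg_sumE w) (linear_sum to_tensor).
by apply: eq_bigr => j _; rewrite -to_tensorU.
Qed.

Lemma ptensor_one x : ptensor x one = to_tensor (const_part x).
Proof.
rewrite {1}(sum_coef bas x) ptensor_suml linear_sum; apply: eq_bigr => j _ /=.
by rewrite to_tensorU ptensorZl -ptensorZr resfield_scale ptensorZr.
Qed.

Lemma to_tensor_surj (t : tensor N k) : exists w, t = to_tensor w.
Proof.
have [s ->] := tensor_sum t.
elim: s => [|[c [x y]] s [w wE]].
  by exists 0; rewrite big_nil linear0.
have [b ->] := resfield_gen y.
exists (const_part (c *: (b%:MP *: x)) + w).
by rewrite big_cons wE linearD /= -ptensor_one /= !ptensorZl ptensorZr.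
Qed.

(** The coordinates of N induce functionals on N (x) K that detect w. *)
Lemma to_tensor_inj w : to_tensor w = 0 -> w = 0.
Proof.
move=> w0; apply/eqP/freeg_eqP => j; rewrite coeff0.
have [h hE] : exists h : {linear tensor N k -> k},
    forall x y, h (ptensor x y) = coef bas j x *: y.
  apply: bilinear_lift => [y c x x'|x c y y'].
    by rewrite coef_is_linear scalerDl scalerA.
  by rewrite scalerDr !scalerA mulrC.
apply: (@res_one_free K n).
have hw : h (to_tensor w) = (coeff j w)%:MP *: one.
  rewrite -{1}(freeg_sumE w) linear_sum.
  rewrite (linear_sum h) (eq_bigr (fun i => (coeff i w * (i == j)%:R)%:MP *: one)).
    rewrite -scaler_suml; congr (_ *: _).
    have [jw|jw] := boolP (j \in dom w).
      rewrite (bigD1_seq j) ?uniq_dom //= eqxx mulr1 big1 ?addr0 // => i /negPf ->.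
      by rewrite mulr0.
    rewrite (coeff_outdom jw) big1_seq // => i /= iw.
    by case: (eqVneq i j) iw jw => [->->//|_]; rewrite mulr0.
  move=> i _; rewrite /= to_tensorU linearZ_LR /= hE coef_vec scalerA.
  by rewrite !mulr_natr; case: (i == j); rewrite ?mulr1n // !mulr0n mpolyC0.
by rewrite -hw w0 linear0.
Qed.

Lemma to_tensor_gtensor_comp a w :
  (forall j, coeff j w != 0 -> gb_deg bas j = a) ->
  gtensor_comp (M := N) (N := resfield_gmod K n) a (to_tensor w).
Proof.
move=> wa; exists [seq ((coeff j w)%:MP *: gb_vec bas j, one) | j <- dom w]; split.
  move=> _ /mapP[j jw ->] /=; exists a, 0; rewrite addr0; split; last first.
    by split=> //; rewrite /gpart /= /resfield_comp eqxx.
  rewrite -(add0r a) -(wa j) -?mem_dom //; apply: gcompZ; last exact: gb_gpart.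
  move=> m; rewrite msuppC; case: ifP => // _; rewrite inE => /eqP ->.
  by apply/ffunP => l; rewrite !ffunE mnm0E.
rewrite big_map -[in LHS](freeg_sumE w) linear_sum; apply: eq_bigr => j _ /=.
by rewrite to_tensorU ptensorZl.
Qed.

Lemma gtensor_comp_to_tensor a t :
  gtensor_comp (M := N) (N := resfield_gmod K n) a t ->
  exists2 w, (forall j, coeff j w != 0 -> gb_deg bas j = a) & t = to_tensor w.
Proof.
move=> [s [sP ->]]; elim: s sP => [|[x y] s IHs] sP.
  exists 0; last by rewrite big_nil linear0.
  by move=> j; rewrite coeff0 eqxx.
have [w wa wE] := IHs (fun z zs => sP z (@mem_behead _ (_ :: _) z zs)).
have [b [c [/= bx [cy bc]]]] := sP _ (mem_head _ _).
rewrite big_cons wE /=; move: cy; rewrite /gpart /= /resfield_comp.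
case: eqP bc => [->|_ _ /= ->]; last by exists w; rewrite ?ptensor0r ?add0r.
rewrite addr0 => ba _; have [d ->] := resfield_gen y.
exists (d *: const_part x + w).
  move=> j; rewrite coeffD coeffZ (const_part_gpart bx) ba.
  have [//|_] := eqVneq (gb_deg bas j) a; rewrite mulr0 add0r; exact: wa.
by rewrite ptensorZr ptensor_one linearP.
Qed.

End TensorResidue.

Arguments const_part {K n N} bas x.
Arguments to_tensor {K n N} bas w.

(** * Betti numbers as dimensions of homology in a single degree *)

Section QuotientDimension.
Variables (R : realType) (K : fieldType) (n : nat) (V : lmodType {mpoly K[n]}).
Implicit Types Z B : set V.

Lemma quot_dim0 Z B : B 0 -> (forall z, Z z -> B z) -> quot_dim R Z B = 0%E.
Proof.
move=> B0 ZB; rewrite /quot_dim; case: pselect => [h|[]]; last first.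
  exists 0%N, (fun=> 0); split=> [[]|z Zz] //.
  exists [ffun=> 0]; split; first by rewrite big_ord0 subr0; apply: ZB.
  by move=> c _; apply/ffunP => -[].
case: (cid h) => -[|k] /= [v [Zv vP]] //.
have [c [_ cU]] := vP _ (Zv ord0).
have /ffunP/(_ ord0) : [ffun=> 0] = [ffun j => (j == ord0)%:R] :> {ffun 'I_k.+1 -> K}.
  rewrite -(cU [ffun=> 0]); last first.
    rewrite big1 ?subr0; first exact: ZB.
    by move=> j _; rewrite ffunE mpolyC0 scale0r.
  apply: cU; rewrite (bigD1 ord0) //= ffunE eqxx mpolyC1 scale1r big1 ?addr0 ?subrr //.
  by move=> j /negPf j0; rewrite ffunE j0 mpolyC0 scale0r.
by rewrite !ffunE eqxx => /esym/eqP; rewrite oner_eq0.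
Qed.

Lemma quot_dim_ge0 Z B : (0 <= quot_dim R Z B)%E.
Proof. by rewrite /quot_dim; case: pselect => h; rewrite ?lee_fin ?ler0n ?le0y. Qed.

(** Independent vectors modulo B are at most as many as the elements of a basis. *)
Lemma quot_dim_ge Z B r :
  (forall c x y, B x -> B y -> B (c%:MP *: x + y)) -> B 0 ->
  dim_ge (V := restrict_scalars V) Z B r -> (r%:R%:E <= quot_dim R Z B)%E.
Proof.
move=> BP B0 [v0 [Zv vI]]; pose v : 'I_r -> V := v0.
rewrite /quot_dim; case: pselect => [h|_]; last exact: leey.
rewrite lee_fin ler_nat; case: (cid h) => k /= [w [Zw wP]].
have /boolp.choice[C CP] (l : 'I_r) : exists c : {ffun 'I_k -> K},
    B (v l - \sum_j (c j)%:MP *: w j).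
  by have [c [? _]] := wP _ (Zv l); exists c.
pose A : 'M[K]_(r, k) := \matrix_(l, j) C l j.
suff /eqP <- : row_free A by apply: rank_leq_col.
rewrite -kermx_eq0; apply/negPn/negP => /rowV0Pn[u /sub_kermxP uA /eqP]; apply.
apply: vI.
have uC0 : \sum_l \sum_j (u 0 l * C l j)%:MP *: w j = 0.
  rewrite exchange_big big1 // => j _; rewrite -scaler_suml -raddf_sum /=.
  have -> : \sum_l u 0 l * C l j = (u *m A) 0 j.
    by rewrite mxE; apply: eq_bigr => l _; rewrite mxE.
  by rewrite uA mxE mpolyC0 scale0r.
have -> : \sum_j u 0 j *: v0 j =
    \sum_l (u 0 l)%:MP *: (v l - \sum_j (C l j)%:MP *: w j) :> V.
  transitivity (\sum_l ((u 0 l)%:MP *: v l - \sum_j (u 0 l * C l j)%:MP *: w j)).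
    by rewrite sumrB uC0 subr0.
  apply: eq_bigr => l _; rewrite scalerBr scaler_sumr; congr (_ - _).
  by apply: eq_bigr => j _; rewrite scalerA -mpolyCM.
apply: (big_ind B) => // [x y Bx By|l _].
  by rewrite -[x]scale1r -mpolyC1; apply: BP.
by rewrite -[_ *: _]addr0; apply: BP.
Qed.

End QuotientDimension.

Lemma freeg_linear_eq (K : fieldType) (T : choiceType) (V : lmodType K)
    (f g : {linear {freeg T / K} -> V}) :
  (forall j, f << j >> = g << j >>) -> f =1 g.
Proof.
move=> fg w; rewrite -(freeg_sumE w) !linear_sum; apply: eq_bigr => j _.
by rewrite freegUZ !linearZ_LR fg.
Qed.

Section BettiNumbers.
Variables (R : realType) (K : fieldType) (n : nat) (M : gmod K n).
Variables (F : graded_free_resolution M) (bas : forall i, graded_basis (F i)).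
Local Notation W := (dehomogenization bas).
Local Notation k := (resfield_gmod K n).
Local Notation full a := (box finset.setT a).

Lemma boxT (a x : Zn n) : full a x = (x == a).
Proof.
apply/boxP/eqP => [xa|-> l]; last by rewrite finset.in_setT.
by apply/ffunP => l; have := xa l; rewrite finset.in_setT.
Qed.

Local Notation chain i := {freeg (fc_basis W i) / K}.

(** The differential of F (x) K in the bases of F: the degree-preserving part of the
    differential of the dehomogenization. *)
Definition res_d0 i (w : chain i.+1) : chain i :=
  fglift (fun j => const_part (bas i) (res_d F i (gb_vec (bas i.+1) j))) w.

Lemma res_d0_linear i : linear (@res_d0 i).
Proof. by move=> c x y; rewrite /res_d0 linearP. Qed.

HB.instance Definition _ i := GRing.isLinear.Build K _ _ *:%R
  (@res_d0 i) (@res_d0_linear i).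

Lemma tensor_id_to_tensor i w :
  tensor_id (N := resfield K n) (res_d F i) (to_tensor (bas i.+1) w) =
  to_tensor (bas i) (res_d0 w).
Proof.
have -> : res_d0 w = \sum_(j <- dom w)
    coeff j w *: const_part (bas i) (res_d F i (gb_vec (bas i.+1) j)).
  rewrite -{1}(freeg_sumE w) (linear_sum (@res_d0 i)).
  by apply: eq_bigr => j _; rewrite /= /res_d0 liftU.
rewrite to_tensorE (linear_sum (tensor_id (res_d F i))) (linear_sum (to_tensor (bas i))).
apply: eq_bigr => j _; rewrite linearZ_LR /= tensor_id_pure (ptensor_one (bas i)).
by rewrite [RHS]linearZ_LR.
Qed.

Lemma truncU i A j : trunc (W := W) A (<< j >> : chain i) =
  if A (gb_deg (bas i) j) then << j >> else 0.
Proof. by rewrite /trunc liftU scale1r. Qed.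

Lemma res_d0U i j : res_d0 << j >> =
  trunc (W := W) (full (gb_deg (bas i.+1) j)) (fc_d W i << j >>).
Proof.
rewrite /res_d0 /= /deh_d !liftU !scale1r; apply/eqP/freeg_eqP => x.
rewrite (const_part_gpart (a := gb_deg (bas i.+1) j)); last first.
  by apply: res_d_graded; apply: gb_gpart.
by rewrite (coeff_trunc (W := W) (i := i)) boxT.
Qed.

Lemma res_d0_trunc i a w : res_d0 (trunc (W := W) (i := i.+1) (full a) w) =
  trunc (full a) (fc_d W i (trunc (full a) w)).
Proof.
pose f := @res_d0 i \o @trunc K n W i.+1 (full a).
pose g := @trunc K n W i (full a) \o fc_d W i \o @trunc K n W i.+1 (full a).
apply: (@freeg_linear_eq _ _ _ f g) => j; rewrite /f /g /= truncU boxT.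
by case: eqP => [<-|_]; [exact: res_d0U | rewrite !linear0].
Qed.

Lemma trunc_res_d0 i a w : trunc (W := W) (i := i) (full a) (res_d0 w) =
  res_d0 (trunc (W := W) (i := i.+1) (full a) w).
Proof.
pose f := @trunc K n W i (full a) \o @res_d0 i.
pose g := @res_d0 i \o @trunc K n W i.+1 (full a).
apply: (@freeg_linear_eq _ _ _ f g) => j; rewrite /f /g /= truncU boxT res_d0U trunc_trunc.
case: eqP => [<-|ja].
  by rewrite res_d0U; apply: (eq_trunc (W := W) (i := i)) => x /=; rewrite andbb.
rewrite (linear0 (@res_d0 i)); apply/eqP/freeg_eqP => x.
rewrite (coeff_trunc (W := W) (i := i)) coeff0 /= !boxT.
by case: eqP => [->|//] /=; case: eqP => // /esym/ja.
Qed.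

Lemma cycle_res_d0 i a w : is_cycle (W := W) (i := i.+1) (full a) w -> res_d0 w = 0.
Proof. by move=> [wa dw]; rewrite -wa res_d0_trunc wa. Qed.

Lemma trunc_full i a (w : chain i) :
  trunc (full a) w = w <-> forall j, coeff j w != 0 -> gb_deg (bas i) j = a.
Proof.
split=> [/trunc_id wa j /wa|wa]; first by rewrite boxT => /eqP.
by apply/trunc_id => j /wa <-; rewrite boxT.
Qed.

Lemma betti_neq0 i a : betti R F i a <> 0%E -> ~ acyclic W i (full a).
Proof.
move=> nz ac; apply: nz; apply: quot_dim0.
  split; first by exists 0; rewrite ?linear0.
  by exists [::]; rewrite big_nil; split.
move=> t [Zt ta]; split=> //.
have [w wa tE] := gtensor_comp_to_tensor (bas i) ta.
have {}wa : trunc (W := W) (full a) w = w by apply/trunc_full.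
have [|u ua wE] := ac w.
  case: i {ac} t w Zt ta tE wa => [//|i] t w Zt ta tE wa; split=> //.
  rewrite -wa -res_d0_trunc wa; apply: (@to_tensor_inj _ _ _ (bas i)).
  by rewrite -tensor_id_to_tensor -tE.
exists (to_tensor (bas i.+1) u) => //.
by rewrite tensor_id_to_tensor tE wE -ua res_d0_trunc ua.
Qed.

Lemma betti_ge i a r : hdim_ge W i (full a) r -> (r%:R%:E <= betti R F i a)%E.
Proof.
move=> [v [Zv vI]]; apply: quot_dim_ge.
- move=> c x y [[x' _ xE] xa] [[y' _ yE] ya]; split.
    by exists (c%:MP *: x' + y') => //; rewrite linearP /= xE yE.
  have [u ua ->] := gtensor_comp_to_tensor (bas i) xa.
  have [w wa ->] := gtensor_comp_to_tensor (bas i) ya.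
  rewrite (_ : _ + _ = to_tensor (bas i) (c *: u + w)); last by rewrite linearP.
  apply: to_tensor_gtensor_comp => j; rewrite coeffD coeffZ => uw.
  have [/ua //|/negPn/eqP u0] := boolP (coeff j u != 0).
  by apply: wa; rewrite u0 mulr0 add0r in uw.
- split; first by exists 0; rewrite ?linear0.
  by exists [::]; rewrite big_nil; split.
have va j : trunc (W := W) (full a) (v j) = v j := cycle_trunc (Zv j).
exists (fun j => to_tensor (bas i) (v j)); split=> [j|c [[t _ tE] _]].
  split; last by apply: to_tensor_gtensor_comp; apply/trunc_full.
  case: i v Zv vI va j => [//|i] v Zv _ _ j /=.
  by rewrite tensor_id_to_tensor (cycle_res_d0 (Zv j)) linear0.
apply: vI; set w := \sum_j _.
have wa : trunc (W := W) (full a) w = w.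
  by rewrite /w linear_sum; apply: eq_bigr => j _; rewrite linearZ_LR /= va.
have [u uE] := to_tensor_surj (bas i.+1) t.
have wE : w = res_d0 u.
  apply/eqP; rewrite -subr_eq0; apply/eqP; apply: (@to_tensor_inj _ _ _ (bas i)).
  rewrite linearB /= -tensor_id_to_tensor -uE; apply/eqP; rewrite subr_eq0; apply/eqP.
  rewrite [RHS]tE (linear_sum (to_tensor (bas i))).
  by apply: eq_bigr => j _; rewrite linearZ_LR.
exists (trunc (W := W) (i := i.+1) (full a) u); first exact: trunc_idem.
by rewrite -res_d0_trunc -trunc_res_d0 -wE wa.
Qed.

End BettiNumbers.

(** * The binomial lower bounds *)

Lemma esum_total_ge (R : realType) (n : nat) (D E : set (Zn n)) (h : Zn n -> nat -> Prop)
    (f : Zn n -> \bar R) N :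
  (forall b r, h b r -> (r%:R%:E <= f b)%E) -> (forall b, D b -> E b) ->
  total_ge h D N -> (N%:R%:E <= \esum_(b in E) f b)%E.
Proof.
move=> hf DE [s [r [us sP Nle]]]; apply: esum_ge; exists [set` s]%classic.
  by split; [exact: finite_seq | move=> b /= /sP[/DE]].
rewrite -fsbig_seq //; apply: le_trans (_ : (\sum_(b <- s) (r b)%:R%:E <= _)%E).
  by rewrite sumEFin -natr_sum lee_fin ler_nat.
by rewrite !big_seq; apply: lee_sum => b /sP[_ /hf].
Qed.

Local Open Scope classical_set_scope.
Local Open Scope ring_scope.

Theorem corollary4p1 (R : realType) (K : fieldType) (n : nat) (M : gmod K n)
    (F : graded_free_resolution M) (p : nat) (a : Zn n) :
  bounded_below M -> (p <= n)%N -> betti R F p a <> 0%E ->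
  (forall i : nat, (i <= p)%N ->
     ('C(p, i)%:R%:E <=
      \esum_(b in [set b : Zn n |
                 Zn_le b a /\ (absdeg b <= absdeg a - p%:Z + i%:Z)%R]) betti R F i b)%E) /\
  (forall i : nat, (i <= p)%N -> ('C(p, i)%:R%:E <= total_betti R F i)%E) /\
  ((2 ^ p)%N%:R%:E <= \sum_(i < p.+1) total_betti R F i)%E.
Proof.
move=> [c Mc] _ nz.
have bas i : graded_basis (F i) := sval (cid (graded_free_basis (res_free F i))).
pose W := dehomogenization bas.
have bounded b i : absdeg b <= c -> acyclic W i (box finset.set0 b).
  move=> bc; case: i => [|i]; last exact: dehomogenization_acyclicS.
  by apply: dehomogenization_acyclic0; apply: Mc.
have higher b i : (0 < i)%N -> acyclic W i (box finset.set0 b).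
  by case: i => // i _; apply: dehomogenization_acyclicS.
have nac : ~ acyclic W (p + 0) (box (finset.setU finset.set0 finset.setT) a).
  by rewrite addn0 finset.set0U; apply: betti_neq0 nz.
have disj : [disjoint finset.set0 & finset.setT : {set 'I_n}]%B.
  by rewrite -finset.setI_eq0 finset.set0I.
have main i : ('C(p, i)%:R%:E <= \esum_(b in [set b : Zn n |
    Zn_le b a /\ (absdeg b <= absdeg a - p%:Z + i%:Z)%R]) betti R F i b)%E.
  have := binomial_bound bounded i disj higher nac; rewrite addn0 finset.set0U.
  apply: esum_total_ge => [b r|b [_ ba bs] //]; exact: betti_ge.
have total i : ('C(p, i)%:R%:E <= total_betti R F i)%E.
  apply: le_trans (main i) _; rewrite esum_mkcond /total_betti; apply: le_esum => b _.
  by case: ifP => // _; apply: quot_dim_ge0.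
do 2!split=> //.
have -> : (2 ^ p = \sum_(i < p.+1) 'C(p, i))%N.
  by rewrite -[2%N]/(1 + 1)%N expnDn; apply: eq_bigr => i _; rewrite !exp1n !muln1.
by rewrite natr_sum -sumEFin; apply: lee_sum.
Qed.
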